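(* Let $n,d\ge 1$ be integers. The abacus Brauer monoid $\mathring{Br}_{d,n}$ is presented by the generators $\mathsf{t}_1,\dots,\mathsf{t}_{n-1}$, $\mathsf{s}_1,\dots,\mathsf{s}_{n-1}$, $\mathsf{o}_1,\dots,\mathsf{o}_n$ subject to the following relations (whenever the indices make sense): $$\mathsf{s}_i^2=1;\quad \mathsf{s}_i\mathsf{s}_j=\mathsf{s}_j\mathsf{s}_i\ (|i-j|>1);\quad \mathsf{s}_i\mathsf{s}_j\mathsf{s}_i=\mathsf{s}_j\mathsf{s}_i\mathsf{s}_j\ (|i-j|=1);$$ $$\mathsf{t}_i^2=\mathsf{t}_i;\quad \mathsf{t}_i\mathsf{t}_j=\mathsf{t}_j\mathsf{t}_i\ (|i-j|>1);\quad \mathsf{t}_i\mathsf{t}_j\mathsf{t}_i=\mathsf{t}_i\ (|i-j|=1);$$ $$\mathsf{t}_i\mathsf{s}_i=\mathsf{s}_i\mathsf{t}_i=\mathsf{t}_i;\quad \mathsf{t}_i\mathsf{s}_j=\mathsf{s}_j\mathsf{t}_i\ (|i-j|>1);\quad \mathsf{s}_i\mathsf{t}_j\mathsf{t}_i=\mathsf{s}_j\mathsf{t}_i,\ \ \mathsf{t}_i\mathsf{t}_j\mathsf{s}_i=\mathsf{t}_i\mathsf{s}_j\ (|i-j|=1);$$ $$\mathsf{o}_i^d=1;\quad \mathsf{o}_i\mathsf{o}_j=\mathsf{o}_j\mathsf{o}_i;\quad \mathsf{t}_i\mathsf{o}_i=\mathsf{t}_i\mathsf{o}_{i+1};\quad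 \mathsf{o}_i\mathsf{t}_i=\mathsf{o}_{i+1}\mathsf{t}_i;\quad \mathsf{o}_i\mathsf{t}_j=\mathsf{t}_j\mathsf{o}_i\ (i\neq j,j+1);\quad \mathsf{t}_i\mathsf{o}_i^k\mathsf{t}_i=\mathsf{t}_i\ (\text{all }k);$$ $$\mathsf{o}_j\mathsf{s}_i=\mathsf{s}_i\mathsf{o}_{s_i(j)},$$ where $s_i(j)$ is the image of $j$ under the transposition $(i,i+1)$. In particular, $\mathring{Br}_{d,n}$ is isomorphic to the framed Brauer monoid $Br_{d,n}$, which therefore has cardinality $(2n-1)!!\,d^n$.
   Context: Abacus Brauer monoid: a Brauer diagram consists of $n$ arcs, drawn between two parallel horizontal lines and allowed to cross, realizing a perfect matching of the $2n$ points $1,\dots,n$ (top line) and $1,\dots,n$ (bottom line); only the matching matters. The elements of $\mathring{Br}_{d,n}$ are the Brauer diagrams in which each arc carries a number of beads in $\{0,\dots,d-1\}$, which slide freely along the arc (also through crossings). The product $ab$ is obtained by placing $a$ above $b$ and concatenating; numbers of beads on arcs that get joined are added modulo $d$, and closed loops (with or without beads or crossings) are discarded. The elements: $\mathsf{t}_i$ is the bead-free diagram joining top $i$ to top $i+1$, bottom $i$ to bottom $i+1$, and top $j$ to bottom $j$ otherwise; $\mathsf{s}_i$ is the bead-free diagram joining top $i$ to bottom $i+1$, top $i+1$ to bottom $i$, and top $j$ to bottom $j$ otherwise; $\mathsf{o}_i$ is the identity diagram with a single bead, on the $i$-th vertical arc (beads counted modulo $d$). Framed Brauer monoid: $Br_{d,n}$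 is the monoid presented by generators $s_1,\dots,s_{n-1},t_1,\dots,t_{n-1},z_1,\dots,z_n$ and the relations: $s_i^2=1$, $s_is_j=s_js_i$ for $|i-j|>1$, $s_is_js_i=s_js_is_j$ for $|i-j|=1$; $t_i^2=t_i$, $t_it_j=t_jt_i$ for $|i-j|>1$, $t_it_jt_i=t_i$ for $|i-j|=1$; $t_is_i=s_it_i=t_i$, $t_is_j=s_jt_i$ for $|i-j|>1$, $s_it_jt_i=s_jt_i$ and $t_it_js_i=t_is_j$ for $|i-j|=1$; $z_i^d=1$, $z_iz_j=z_jz_i$, $z_js_i=s_iz_{s_i(j)}$; $t_iz_i=t_iz_{i+1}$, $z_it_i=z_{i+1}t_i$, $z_it_j=t_jz_i$ for $i\ne j,j+1$, $t_iz_i^kt_i=t_i$ for all $k$. *)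

(* Defs.v *)
From HB Require Import structures.
From mathcomp Require Import all_boot all_order all_algebra perm.
From mathcomp Require Import boolp classical_sets cardinality.

Set Implicit Arguments.
Unset Strict Implicit.
Unset Printing Implicit Defensive.

Import GRing.Theory.

Section Presentation.
Variables (X : choiceType) (R : seq X -> seq X -> Prop).

Inductive wcong : seq X -> seq X -> Prop :=
| wcong_rel l u v r : R u v -> wcong (l ++ u ++ r) (l ++ v ++ r)
| wcong_refl u : wcong u u
| wcong_sym u v : wcong u v -> wcong v u
| wcong_trans u v w : wcong u v -> wcong v w -> wcong u w.

Lemma wcong_ctx l r u v : wcong u v -> wcong (l ++ u ++ r) (l ++ v ++ r).
Proof.
elim=> {u v} [l' u v r' Ruv|u|u v _|u v w _ IH1 _ IH2].
- rewrite -!catA !(catA l); exact: wcong_rel.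
- exact: wcong_refl.
- exact: wcong_sym.
- exact: wcong_trans IH1 IH2.
Qed.

Lemma wcong_cat u u' v v' : wcong u u' -> wcong v v' -> wcong (u ++ v) (u' ++ v').
Proof.
move=> uu' vv'; apply: (@wcong_trans _ (u' ++ v)).
  exact: (wcong_ctx [::] v uu').
by have := wcong_ctx u' [::] vv'; rewrite !cats0.
Qed.

Definition wcongb (u v : seq X) : bool := `[< wcong u v >].

Lemma wcongb_refl : reflexive wcongb.
Proof. by move=> u; apply/asboolP; apply: wcong_refl. Qed.
Lemma wcongb_sym : symmetric wcongb.
Proof. by move=> u v; apply/asboolP/asboolP; apply: wcong_sym. Qed.
Lemma wcongb_trans : transitive wcongb.
Proof.
move=> v u w /asboolP uv /asboolP vw; apply/asboolP; exact: wcong_trans uv vw.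
Qed.
Canonical wcong_equiv := EquivRel wcongb wcongb_refl wcongb_sym wcongb_trans.

Definition presented := {eq_quot wcongb}%qT.
HB.instance Definition _ := Choice.copy presented {eq_quot wcongb}%qT.

Definition pres_class (u : seq X) : presented := (\pi_({eq_quot wcongb}) u)%qT.

Lemma pres_classP u v : pres_class u = pres_class v <-> wcong u v.
Proof.
split=> [/eqP|uv]; last by apply/eqP; rewrite eqmodE; apply/asboolP.
by rewrite eqmodE => /asboolP.
Qed.

Lemma pres_reprK (x : presented) : pres_class (repr x) = x.
Proof. exact: reprK. Qed.

Definition pres_mul (x y : presented) : presented :=
  pres_class (repr x ++ repr y).

Lemma pres_mulE u v :
  pres_mul (pres_class u) (pres_class v) = pres_class (u ++ v).
Proof. by apply/pres_classP/wcong_cat; apply/pres_classP/pres_reprK. Qed.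

Lemma pres_mulA : associative pres_mul.
Proof.
move=> x y z; rewrite -(pres_reprK x) -(pres_reprK y) -(pres_reprK z).
by rewrite !pres_mulE catA.
Qed.

Lemma pres_mul1 : left_id (pres_class [::]) pres_mul.
Proof. by move=> x; rewrite -(pres_reprK x) pres_mulE. Qed.

Lemma pres_1mul : right_id (pres_class [::]) pres_mul.
Proof. by move=> x; rewrite -(pres_reprK x) pres_mulE cats0. Qed.

HB.instance Definition _ :=
  isMonoid.Build presented pres_mulA pres_mul1 pres_1mul.

Definition pres_gen (x : X) : presented := pres_class [:: x].

Definition presented_by (M : monoidType) (g : X -> M) : Prop :=
  exists phi : UMagmaMorphism.type presented M,
    bijective phi /\ forall x, phi (pres_gen x) = g x.

End Presentation.

Definition monoid_isomorphic (M N : monoidType) : Prop :=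
  exists phi : UMagmaMorphism.type M N, bijective phi.

(* The indices 1, ..., n and 1, ..., n-1 are shifted to ['I_n] and ['I_n.-1];
   [lo i] and [hi i] are the elements of ['I_n] standing for i and i+1. *)
Section Indices.
Variable n : nat.

Definition lo (i : 'I_n.-1) : 'I_n := widen_ord (leq_pred n) i.

Lemma hi_subproof (i : 'I_n.-1) : (i.+1 < n)%N.
Proof. by case: n i => [|m] [] //=. Qed.

Definition hi (i : 'I_n.-1) : 'I_n := Ordinal (hi_subproof i).

Definition far (i j : 'I_n.-1) : bool := (i.+1 < j)%N || (j.+1 < i)%N.
Definition adjacent (i j : 'I_n.-1) : bool :=
  (i.+1 == j :> nat) || (j.+1 == i :> nat).

Lemma lo_neq_hi i : lo i != hi i.
Proof. by rewrite -val_eqE /= neq_ltn ltnSn. Qed.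

End Indices.

Inductive fgen (n : nat) : Type :=
| FS of 'I_n.-1
| FT of 'I_n.-1
| FZ of 'I_n.
Arguments FS {n} _.
Arguments FT {n} _.
Arguments FZ {n} _.

Section FgenChoice.
Variable n : nat.
Definition fgen_code (x : fgen n) : 'I_n.-1 + 'I_n.-1 + 'I_n :=
  match x with FS i => inl (inl i) | FT i => inl (inr i) | FZ j => inr j end.
Definition fgen_decode (c : 'I_n.-1 + 'I_n.-1 + 'I_n) : fgen n :=
  match c with inl (inl i) => FS i | inl (inr i) => FT i | inr j => FZ j end.
Lemma fgen_codeK : cancel fgen_code fgen_decode. Proof. by case. Qed.
HB.instance Definition _ := Finite.copy (fgen n) (can_type fgen_codeK).
End FgenChoice.

(* With [FZ] read either as the framing generator z or as the bead generator o,
   these are the defining relations of both monoids. *)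
Inductive framed_rel (d n : nat) : seq (fgen n) -> seq (fgen n) -> Prop :=
| rel_ss i : framed_rel d [:: FS i; FS i] [::]
| rel_ss_far i j : far i j ->
    framed_rel d [:: FS i; FS j] [:: FS j; FS i]
| rel_sss i j : adjacent i j ->
    framed_rel d [:: FS i; FS j; FS i] [:: FS j; FS i; FS j]
| rel_tt i : framed_rel d [:: FT i; FT i] [:: FT i]
| rel_tt_far i j : far i j ->
    framed_rel d [:: FT i; FT j] [:: FT j; FT i]
| rel_ttt i j : adjacent i j ->
    framed_rel d [:: FT i; FT j; FT i] [:: FT i]
| rel_ts i : framed_rel d [:: FT i; FS i] [:: FT i]
| rel_st i : framed_rel d [:: FS i; FT i] [:: FT i]
| rel_ts_far i j : far i j ->
    framed_rel d [:: FT i; FS j] [:: FS j; FT i]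
| rel_stt i j : adjacent i j ->
    framed_rel d [:: FS i; FT j; FT i] [:: FS j; FT i]
| rel_tts i j : adjacent i j ->
    framed_rel d [:: FT i; FT j; FS i] [:: FT i; FS j]
| rel_zd j : framed_rel d (nseq d (FZ j)) [::]
| rel_zz i j : framed_rel d [:: FZ i; FZ j] [:: FZ j; FZ i]
| rel_zs i j :
    framed_rel d [:: FZ j; FS i] [:: FS i; FZ (tperm (lo i) (hi i) j)]
| rel_tz i : framed_rel d [:: FT i; FZ (lo i)] [:: FT i; FZ (hi i)]
| rel_zt i : framed_rel d [:: FZ (lo i); FT i] [:: FZ (hi i); FT i]
| rel_zt_far i j : i != lo j -> i != hi j ->
    framed_rel d [:: FZ i; FT j] [:: FT j; FZ i]
| rel_tzt i k :
    framed_rel d (FT i :: nseq k (FZ (lo i)) ++ [:: FT i]) [:: FT i].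

Definition framed_brauer (d n : nat) : monoidType :=
  presented (@framed_rel d n).

Fixpoint dfact (m : nat) : nat := if m is m'.+2 then (m * dfact m')%N else 1.

(* [inl i] is the i-th point of the top line, [inr i] of the bottom line. *)
Definition point (n : nat) := ('I_n + 'I_n)%type.

(* For [0 < d], this is ['I_d] in a form that carries addition modulo d for
   all such d, including d = 1. *)
Definition bead (d : nat) := 'I_d.-1.+1.

Section Strands.
Variables (V : finType) (W : zmodType).
Variables (arc : V -> V) (wt : V -> W) (glue : V -> option V).

(* Starting from [v], traverse the arc at [v]; as long as the endpoint reached
   is glued to a point, continue from there. Returns the last endpoint and the
   total weight of the arcs traversed. A strand starting at an unglued point
   never visits a point twice, so that [#|V|] is enough fuel. *)
Fixpoint strand (fuel : nat) (v : V) : V * W :=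
  if fuel is k.+1 then
    if glue (arc v) is Some u then
      let: (y, w) := strand k u in (y, (wt v + w)%R)
    else (arc v, wt v)
  else (arc v, wt v).

(* [seg k v y w]: traversing k+1 arcs from [v] leads to [y], with weight [w]. *)
Inductive seg : nat -> V -> V -> W -> Prop :=
| seg_one v : seg 0 v (arc v) (wt v)
| seg_step k v u y w : glue (arc v) = Some u -> seg k u y w ->
    seg k.+1 v y (wt v + w)%R.

Lemma seg_fun k l v y y' w w' : seg k v y w -> seg l v y' w' ->
  glue y = None -> glue y' = None -> y = y' /\ w = w'.
Proof.
move=> H; elim: H l y' w' => {k v y w} [v|k v u y w guv _ IH] l y' w' H'.
  by case: H' => // {}k {}v u y w -> _.
case: H' guv IH => [{}v -> _ _ //|l' {}v u' {}y' {}w' -> H' [<-] IH gy gy'].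
by have [-> ->] := IH _ _ _ H' gy gy'.
Qed.

Lemma seg_cat k l v y u z w w' : seg k v y w -> glue y = Some u ->
  seg l u z w' -> seg (k + l).+1 v z (w + w')%R.
Proof.
move=> H; elim: H l u z w' => {k v y w} [v|k v u y w guv _ IH] l u' z w' gy H'.
  exact: seg_step gy H'.
by rewrite -addrA addSn; apply: seg_step guv _; apply: IH gy H'.
Qed.

Hypothesis arcK : involutive arc.
Hypothesis arc_neq : forall v, arc v != v.
Hypothesis wt_arc : forall v, wt (arc v) = wt v.
Hypothesis glueK : forall u v, glue u = Some v -> glue v = Some u.
Hypothesis glue_neq : forall v, glue v != Some v.

Lemma seg_rev k v y w : seg k v y w -> seg k y v w.
Proof.
elim=> {k v y w} [v|k v u y w guv _ IH].
  by rewrite -{2}(arcK v) -wt_arc; apply: seg_one.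
have := seg_cat IH (glueK guv) (seg_one (arc v)).
by rewrite arcK wt_arc addn0 addrC.
Qed.

Lemma seg_last k v y w : seg k.+1 v y w ->
  exists u z w', [/\ seg k v z w', glue z = Some u & y = arc u].
Proof.
move/seg_rev=> H; inversion H as [|k' v' u y' w' guv H' E1 E2]; subst.
exists (arc y), u, w'; split; last by rewrite arcK.
- exact: seg_rev.
- exact: glueK.
Qed.

Lemma seg_neq k v y w : seg k v y w -> y <> v.
Proof.
have [m] := ubnP k; elim: m => // m IHm in k v y w *; rewrite ltnS => km H Eyv.
case: H km Eyv => {k v y w} [v _ Eyv|k v u y w guv H km Eyv].
  by have := arc_neq v; rewrite Eyv eqxx.
subst y; case: k H km => [|k] H km.
  inversion H; subst; have := glue_neq (arc (arc u)).
  by rewrite guv arcK eqxx.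
have [u' [z [w' [Hz gz E]]]] := seg_last H.
have Ezu : z = u by move: (glueK gz) guv; rewrite E arcK => -> [->].
by subst z; exact: (IHm _ _ _ _ (ltnW km) Hz erefl).
Qed.

Let next v := odflt (arc v) (glue (arc v)).

Lemma next_inj : injective next.
Proof.
move=> v v'; rewrite /next => E; apply: (can_inj arcK); move: E.
case gv: (glue (arc v)) => [u|]; case gv': (glue (arc v')) => [u'|] //= E.
- by have := glueK gv; rewrite E (glueK gv') => - [].
- by have := glueK gv; rewrite E gv'.
- by have := glueK gv'; rewrite -E gv.
Qed.

Lemma strand_ends v : glue v = None ->
  exists2 k, (k < #|V|)%N & glue (arc (iter k next v)) = None.
Proof.
move=> gv; pose m := order next v.
have m_gt0 : (0 < m)%N by apply: order_gt0.
have [k Pk|noP] := pickP (fun k : 'I_m => glue (arc (iter k next v)) == None).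
  exists k; last exact/eqP.
  by apply: leq_trans (ltn_ord k) _; apply: max_card.
have lt_m : (m.-1 < m)%N by rewrite prednK.
have Ev : next (iter m.-1 next v) = v.
  by rewrite -iterS (prednK m_gt0); apply: iter_order next_inj v.
have /= := noP (Ordinal lt_m); move: Ev; rewrite /next -/next.
case gu: (glue _) => [u|] //= Eu _.
by have := glueK gu; rewrite Eu gv.
Qed.

Lemma strand_seg_fuel f k v : (k < f)%N -> glue (arc (iter k next v)) = None ->
  glue (strand f v).1 = None /\
  exists l, seg l v (strand f v).1 (strand f v).2.
Proof.
elim: f k v => // f IHf k v kf gk /=.
case gv: (glue (arc v)) => [u|] /=; last by split=> //; exists 0%N; constructor.
case: k kf gk => [|k] kf; first by rewrite /= gv.
rewrite iterSr {2}/next gv /= => gk.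
have [] := IHf _ _ kf gk; case: strand => y w /= gy [l H]; split=> //.
by exists l.+1; apply: seg_step gv H.
Qed.

Lemma strand_seg v : glue v = None ->
  glue (strand #|V| v).1 = None /\
  exists l, seg l v (strand #|V| v).1 (strand #|V| v).2.
Proof. by case/strand_ends=> k; apply: strand_seg_fuel. Qed.

Lemma strand_eq k v y w : glue v = None -> glue y = None -> seg k v y w ->
  strand #|V| v = (y, w).
Proof.
move=> gv gy H; have [gy' [l H']] := strand_seg gv.
by have [] := seg_fun H' H gy' gy; case: strand => ? ? /= -> ->.
Qed.

End Strands.

Section Abacus.
Variables d n : nat.
Local Notation point := (point n).
Local Notation bead := (bead d).

(* A matching of the points, as a fixed-point-free involution sending each point
   to the other end of its arc, with a number of beads on each arc, as a function
   of the points taking equal values at both ends of each arc. *)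
Definition is_abacus (D : {ffun point -> point} * {ffun point -> bead}) : bool :=
  [forall x, [&& D.1 (D.1 x) == x, D.1 x != x & D.2 (D.1 x) == D.2 x]].

Record abacus : Type := Abacus {
  abacus_data : {ffun point -> point} * {ffun point -> bead};
  _ : is_abacus abacus_data
}.

HB.instance Definition _ := [isSub for abacus_data].
HB.instance Definition _ := [Finite of abacus by <:].

Definition partner (a : abacus) (x : point) : point := (abacus_data a).1 x.
Definition beads (a : abacus) (x : point) : bead := (abacus_data a).2 x.

Lemma abacusP (a : abacus) x : [/\ partner a (partner a x) = x,
  partner a x != x & beads a (partner a x) = beads a x].
Proof. by have /forallP/(_ x)/and3P[/eqP ? ? /eqP ?] := valP a. Qed.

Lemma partnerK a : involutive (partner a).
Proof. by move=> x; case: (abacusP a x). Qed.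
Lemma partner_neq a x : partner a x != x.
Proof. by case: (abacusP a x). Qed.
Lemma beads_partner a x : beads a (partner a x) = beads a x.
Proof. by case: (abacusP a x). Qed.

Lemma abacus_ext a b :
  (forall x, partner a x = partner b x /\ beads a x = beads b x) -> a = b.
Proof.
move=> H; apply: val_inj; case: a b H => [[f g] Da] [[f' g'] Db] H /=.
by congr pair; apply/ffunP => x; have [] := H x.
Qed.

Lemma mk_subproof (f : point -> point) (g : point -> bead) :
  involutive f -> (forall x, f x != x) -> (forall x, g (f x) = g x) ->
  is_abacus (finfun f, finfun g).
Proof. by move=> fK fN gf; apply/forallP=> x; rewrite /= !ffunE fK fN gf !eqxx. Qed.

Definition mk_abacus f g fK fN gf := Abacus (@mk_subproof f g fK fN gf).

Lemma partner_mk f g fK fN gf : partner (@mk_abacus f g fK fN gf) =1 f.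
Proof. by move=> x; rewrite /partner /= ffunE. Qed.
Lemma beads_mk f g fK fN gf : beads (@mk_abacus f g fK fN gf) =1 g.
Proof. by move=> x; rewrite /beads /= ffunE. Qed.

(* The points of two stacked diagrams, [inl] for the upper and [inr] for the
   lower one; the bottom line of the former is glued to the top line of the
   latter. *)
Definition stacked := (point + point)%type.

Definition stack_arc (a b : abacus) (v : stacked) : stacked :=
  match v with inl x => inl (partner a x) | inr x => inr (partner b x) end.

Definition stack_beads (a b : abacus) (v : stacked) : bead :=
  match v with inl x => beads a x | inr x => beads b x end.

Definition stack_glue (v : stacked) : option stacked :=
  match v with
  | inl (inr i) => Some (inr (inl i))
  | inr (inl i) => Some (inl (inr i))
  | _ => None
  end.

Definition outer (x : point) : stacked :=
  match x with inl i => inl (inl i) | inr i => inr (inr i) end.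

Definition unstack (v : stacked) : point := match v with inl x | inr x => x end.

Definition concat_strand (a b : abacus) (x : point) : stacked * bead :=
  strand (stack_arc a b) (stack_beads a b) stack_glue #|{: stacked}| (outer x).

Definition concat_partner a b (x : point) : point :=
  unstack (concat_strand a b x).1.
Definition concat_beads a b (x : point) : bead := (concat_strand a b x).2.

Local Notation sseg a b :=
  (seg (stack_arc a b) (stack_beads a b) stack_glue).

Lemma stack_arcK a b : involutive (stack_arc a b).
Proof. by case=> x /=; rewrite partnerK. Qed.
Lemma stack_arc_neq a b v : stack_arc a b v != v.
Proof. by case: v => x /=; [rewrite (inj_eq inl_inj)|rewrite (inj_eq inr_inj)];
  apply: partner_neq. Qed.
Lemma stack_beads_arc a b v : stack_beads a b (stack_arc a b v) = stack_beads a b v.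
Proof. by case: v => x /=; rewrite beads_partner. Qed.
Lemma stack_glueK u v : stack_glue u = Some v -> stack_glue v = Some u.
Proof. by case: u => -[i|i] //= [<-]. Qed.
Lemma stack_glue_neq v : stack_glue v != Some v.
Proof. by case: v => -[i|i]. Qed.
Lemma glue_outer x : stack_glue (outer x) = None.
Proof. by case: x. Qed.
Lemma outer_unstack v : stack_glue v = None -> outer (unstack v) = v.
Proof. by case: v => -[i|i]. Qed.
Lemma outerK : cancel outer unstack. Proof. by case. Qed.

Lemma concat_seg a b x : exists k,
  sseg a b k (outer x) (outer (concat_partner a b x)) (concat_beads a b x).
Proof.
have [g [k H]] := strand_seg (stack_beads a b) (stack_arcK a b) stack_glueK
  (glue_outer x).
by exists k; rewrite outer_unstack.
Qed.

Lemma concat_eq k a b x y w : sseg a b k (outer x) (outer y) w ->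
  concat_partner a b x = y /\ concat_beads a b x = w.
Proof.
move=> H; rewrite /concat_partner /concat_beads /concat_strand.
by rewrite (strand_eq (stack_arcK a b) stack_glueK _ _ H) ?glue_outer //= outerK.
Qed.

Lemma concat_rev a b x :
  concat_partner a b (concat_partner a b x) = x /\
  concat_beads a b (concat_partner a b x) = concat_beads a b x.
Proof.
have [k H] := concat_seg a b x; apply: (@concat_eq k).
exact: (seg_rev (stack_arcK a b) (stack_beads_arc a b) stack_glueK H).
Qed.

Lemma concat_partnerK a b : involutive (concat_partner a b).
Proof. by move=> x; case: (concat_rev a b x). Qed.
Lemma concat_partner_neq a b x : concat_partner a b x != x.
Proof.
have [k H] := concat_seg a b x; apply/eqP=> E.
apply: (seg_neq (stack_arcK a b) (stack_arc_neq a b) (stack_beads_arc a b)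
  stack_glueK stack_glue_neq H).
by rewrite E.
Qed.
Lemma concat_beads_partner a b x :
  concat_beads a b (concat_partner a b x) = concat_beads a b x.
Proof. by case: (concat_rev a b x). Qed.

Definition concat (a b : abacus) : abacus :=
  mk_abacus (concat_partnerK a b) (concat_partner_neq a b)
    (concat_beads_partner a b).

Definition flip (x : point) : point :=
  match x with inl i => inr i | inr i => inl i end.
Lemma flipK : involutive flip. Proof. by case. Qed.
Lemma flip_neq x : flip x != x. Proof. by case: x. Qed.

Definition abacus1 : abacus :=
  @mk_abacus flip (fun=> 0%R) flipK flip_neq (fun=> erefl).

Lemma sseg_one a b v y w : stack_arc a b v = y -> stack_beads a b v = w ->
  sseg a b 0 v y w.
Proof. by move=> <- <-; constructor. Qed.

Lemma concat_1l : left_id abacus1 concat.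
Proof.
move=> a; apply: abacus_ext => x; rewrite partner_mk beads_mk.
have e1 i : stack_arc abacus1 a (inl i) = inl (flip i).
  by rewrite /= partner_mk.
have e2 i : stack_beads abacus1 a (inl i) = 0%R by rewrite /= beads_mk.
have [k H] : exists k, sseg abacus1 a k (inr x) (outer (partner a x)) (beads a x).
  case E: (partner a x) => [j|j]; last by exists 0%N; apply: sseg_one; rewrite /= ?E.
  exists 1%N; rewrite -[beads a x]addr0.
  apply: (@seg_step _ _ _ _ _ _ _ (inl (inr j))); first by rewrite /= E.
  by apply: sseg_one; rewrite ?e1 ?e2.
case: x H => [i|i] H; last exact: (@concat_eq _ _ _ (inr i) _ _ H).
apply: (@concat_eq k.+1); rewrite -[beads a _]add0r -(e2 (inl i)).
by apply: seg_step H; rewrite e1.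
Qed.

Lemma concat_1r : right_id abacus1 concat.
Proof.
move=> a; apply: abacus_ext => x; rewrite partner_mk beads_mk.
have e1 i : stack_arc a abacus1 (inr i) = inr (flip i).
  by rewrite /= partner_mk.
have e2 i : stack_beads a abacus1 (inr i) = 0%R by rewrite /= beads_mk.
have [k H] : exists k, sseg a abacus1 k (inl x) (outer (partner a x)) (beads a x).
  case E: (partner a x) => [j|j]; first by exists 0%N; apply: sseg_one; rewrite /= ?E.
  exists 1%N; rewrite -[beads a x]addr0.
  apply: (@seg_step _ _ _ _ _ _ _ (inr (inl j))); first by rewrite /= E.
  by apply: sseg_one; rewrite ?e1 ?e2.
case: x H => [i|i] H; first exact: (@concat_eq _ _ _ (inl i) _ _ H).
apply: (@concat_eq k.+1); rewrite -[beads a _]add0r -(e2 (inr i)).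
by apply: seg_step H; rewrite e1.
Qed.

Let stacked3 := (point + point + point)%type.

Let arc3 a b c (v : stacked3) : stacked3 :=
  match v with
  | inl (inl x) => inl (inl (partner a x))
  | inl (inr x) => inl (inr (partner b x))
  | inr x => inr (partner c x)
  end.
Let beads3 a b c (v : stacked3) : bead :=
  match v with
  | inl (inl x) => beads a x
  | inl (inr x) => beads b x
  | inr x => beads c x
  end.
Let glue3 (v : stacked3) : option stacked3 :=
  match v with
  | inl (inl (inr i)) => Some (inl (inr (inl i)))
  | inl (inr (inl i)) => Some (inl (inl (inr i)))
  | inl (inr (inr i)) => Some (inr (inl i))
  | inr (inl i) => Some (inl (inr (inr i)))
  | _ => None
  end.
Let outer3 (x : point) : stacked3 :=
  match x with inl i => inl (inl (inl i)) | inr i => inr (inr i) end.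

Local Notation seg3 a b c := (seg (arc3 a b c) (beads3 a b c) glue3).

(* The sub-diagrams ab and bc of the three-diagram stack. *)
Let embL (v : stacked) : stacked3 := inl v.
Let embR (v : stacked) : stacked3 :=
  match v with inl x => inl (inr x) | inr x => inr x end.

Lemma seg3_L a b c k v y w : sseg a b k v y w -> seg3 a b c k (embL v) (embL y) w.
Proof.
elim=> {k v y w} [v|k v u y w guv _ IH].
  by case: v => x; [exact: (seg_one (arc3 a b c) (beads3 a b c) glue3 (inl (inl x)))
    | exact: (seg_one (arc3 a b c) (beads3 a b c) glue3 (inl (inr x)))].
have -> : stack_beads a b v = beads3 a b c (embL v) by case: v {guv}.
apply: seg_step IH; case: v guv => x /=; case: (partner _ x) => //= i [<-] //.
Qed.

Lemma seg3_R a b c k v y w : sseg b c k v y w -> seg3 a b c k (embR v) (embR y) w.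
Proof.
elim=> {k v y w} [v|k v u y w guv _ IH].
  by case: v => x; [exact: (seg_one (arc3 a b c) (beads3 a b c) glue3 (inl (inr x)))
    | exact: (seg_one (arc3 a b c) (beads3 a b c) glue3 (inr x))].
have -> : stack_beads b c v = beads3 a b c (embR v) by case: v {guv}.
apply: seg_step IH; case: v guv => x /=; case: (partner _ x) => //= i [<-] //.
Qed.

Let foldL (v : stacked) : stacked3 :=
  match v with inl x => embL (outer x) | inr x => inr x end.
Let foldR (v : stacked) : stacked3 :=
  match v with inl x => inl (inl x) | inr x => embR (outer x) end.

Lemma seg3_foldL a b c k v y w : sseg (concat a b) c k v y w ->
  exists l, seg3 a b c l (foldL v) (foldL y) w.
Proof.
have arcL v' : exists l, seg3 a b c l (foldL v')
    (foldL (stack_arc (concat a b) c v')) (stack_beads (concat a b) c v').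
  case: v' => x.
    have [l H] := concat_seg a b x; exists l.
    by rewrite /= partner_mk beads_mk; apply: seg3_L H.
  by exists 0%N; apply: (seg_one (arc3 a b c) (beads3 a b c) glue3 (inr x)).
elim=> {k v y w} [v|k v u y w guv _ [l IH]]; first exact: arcL.
have [m H] := arcL v; exists (m + l).+1; apply: seg_cat H _ IH.
by case: (stack_arc _ _ v) guv => -[i|i] //= [<-].
Qed.

Lemma seg3_foldR a b c k v y w : sseg a (concat b c) k v y w ->
  exists l, seg3 a b c l (foldR v) (foldR y) w.
Proof.
have arcR v' : exists l, seg3 a b c l (foldR v')
    (foldR (stack_arc a (concat b c) v')) (stack_beads a (concat b c) v').
  case: v' => x; last first.
    have [l H] := concat_seg b c x; exists l.
    by rewrite /= partner_mk beads_mk; apply: seg3_R H.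
  by exists 0%N; apply: (seg_one (arc3 a b c) (beads3 a b c) glue3 (inl (inl x))).
elim=> {k v y w} [v|k v u y w guv _ [l IH]]; first exact: arcR.
have [m H] := arcR v; exists (m + l).+1; apply: seg_cat H _ IH.
by case: (stack_arc _ _ v) guv => -[i|i] //= [<-].
Qed.

Lemma concatA : associative concat.
Proof.
move=> a b c; apply: abacus_ext => x.
rewrite [concat a (concat b c)]/concat [concat (concat a b) c]/concat.
rewrite !partner_mk !beads_mk.
have [k /seg3_foldR [l H]] := concat_seg a (concat b c) x.
have [k' /seg3_foldL [l' H']] := concat_seg (concat a b) c x.
have eR y : foldR (outer y) = outer3 y by case: y.
have eL y : foldL (outer y) = outer3 y by case: y.
have g y : glue3 (outer3 y) = None by case: y.
move: H H'; rewrite !eR !eL => H H'.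
have [E ->] := seg_fun H H' (g _) (g _); split=> //.
by move: E; case: concat_partner => i; case: concat_partner => j //= [->].
Qed.

HB.instance Definition _ := isMonoid.Build abacus concatA concat_1l concat_1r.

Definition cup_partner (i : 'I_n.-1) (x : point) : point :=
  match x with
  | inl j => if j \in [:: lo i; hi i] then inl (tperm (lo i) (hi i) j) else inr j
  | inr j => if j \in [:: lo i; hi i] then inr (tperm (lo i) (hi i) j) else inl j
  end.

Lemma mem_lohi (i : 'I_n.-1) j :
  (tperm (lo i) (hi i) j \in [:: lo i; hi i]) = (j \in [:: lo i; hi i]).
Proof. by rewrite !inE; case: tpermP => [->|->|_ _]; rewrite ?eqxx ?orbT. Qed.

Lemma cup_partnerK i : involutive (cup_partner i).
Proof.
by case=> j /=; case: ifP => E /=; rewrite ?mem_lohi E ?tpermK.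
Qed.

Lemma tperm_lohi_neq (i : 'I_n.-1) j : j \in [:: lo i; hi i] ->
  tperm (lo i) (hi i) j != j.
Proof.
rewrite !inE => /orP[]/eqP->; rewrite ?tpermL ?tpermR ?lo_neq_hi //.
by rewrite eq_sym lo_neq_hi.
Qed.

Lemma cup_partner_neq i x : cup_partner i x != x.
Proof.
case: x => j /=; case: ifP => // E.
  by rewrite (inj_eq inl_inj) tperm_lohi_neq.
by rewrite (inj_eq inr_inj) tperm_lohi_neq.
Qed.

Definition abacus_t (i : 'I_n.-1) : abacus :=
  @mk_abacus (cup_partner i) (fun=> 0%R) (@cup_partnerK i) (@cup_partner_neq i)
    (fun=> erefl).

Definition cross_partner (i : 'I_n.-1) (x : point) : point :=
  match x with
  | inl j => inr (tperm (lo i) (hi i) j)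
  | inr j => inl (tperm (lo i) (hi i) j)
  end.

Lemma cross_partnerK i : involutive (cross_partner i).
Proof. by case=> j /=; rewrite tpermK. Qed.
Lemma cross_partner_neq i x : cross_partner i x != x.
Proof. by case: x. Qed.

Definition abacus_s (i : 'I_n.-1) : abacus :=
  @mk_abacus (cross_partner i) (fun=> 0%R) (@cross_partnerK i)
    (@cross_partner_neq i) (fun=> erefl).

(* [inZp 1] is 0 when d = 1. *)
Definition one_bead (i : 'I_n) (x : point) : bead :=
  if (match x with inl j | inr j => j end) == i then inZp 1 else 0%R.
Lemma one_bead_flip i x : one_bead i (flip x) = one_bead i x.
Proof. by case: x. Qed.

Definition abacus_o (i : 'I_n) : abacus :=
  @mk_abacus flip (one_bead i) flipK flip_neq (one_bead_flip i).

Definition abacus_gen (x : fgen n) : abacus :=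
  match x with
  | FS i => abacus_s i
  | FT i => abacus_t i
  | FZ i => abacus_o i
  end.

End Abacus.

(* Main.v *)
Require Import Defs.
From HB Require Import structures.
From mathcomp Require Import all_boot all_algebra perm zify.
From mathcomp Require Import classical_sets cardinality.

(* Evaluating words gives a morphism from the presented monoid M_n onto the
   monoid of abacus diagrams, and both sides are squeezed by counting.

   Upper bound for M_n.  Let M_m be the submonoid generated by the letters acting
   on the first m points and G_m its subgroup generated by the s's and z's.  With
   indices from 0, every element of M_(m+1) has one of the two forms
     a z_m^e s_(m-1) ... s_k         (a in M_m, k <= m),
     s_j ... s_(m-2) z_(m-1)^e t_(m-1) y  (y in M_m, j <= m-1),
   according to whether the top end of the last strand goes to the bottom or the
   top line: (2m+1) d choices besides an element of M_m.  The inductive step rests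
   on t_m M_(m+2) = t_m M_(m+1), which yields M_(m+2) = G_(m+2) u G_(m+2) t_m M_(m+1)
   and leaves only a product of short words to be rewritten.

   Lower bound for the diagrams: choose the partner of a point and the number of
   beads on its arc, and recurse.

   Surjectivity and the relations use left multiplication: s_i exchanges two points,
   o_i adds a bead to an arc and t_i joins the arcs through two points.  These
   operators make sense for any points of a diagram, and exchanging points is
   compatible with all of them, so that most relations reduce to one identity: if u is
   joined to w by an arc without beads, then joining at u and v is the same as
   exchanging v and w. *)

Set Implicit Arguments.
Unset Strict Implicit.
Unset Printing Implicit Defensive.

Import GRing.Theory.

(** * Submonoids generated by a subset *)

Section Span.
Local Open Scope group_scope.
Variable M : monoidType.
Implicit Types (X Y : M -> Prop) (x y a b : M).

Inductive mspan X : M -> Prop :=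
| mspan1 : mspan X 1
| mspan_cons a x : X a -> mspan X x -> mspan X (a * x).

Lemma mspan_gen X a : X a -> mspan X a.
Proof. by move=> Xa; rewrite -(mulg1 a); apply: mspan_cons Xa (mspan1 X). Qed.

Lemma mspan_mul X x y : mspan X x -> mspan X y -> mspan X (x * y).
Proof.
move=> Xx Xy; elim: Xx => [|a {}x Xa _ IH]; first by rewrite mul1g.
by rewrite -mulgA; apply: mspan_cons.
Qed.

Lemma mspan_exp X x e : mspan X x -> mspan X (x ^+ e).
Proof.
move=> Xx; elim: e => [|e IH]; first exact: mspan1.
by rewrite expgS; apply: mspan_mul.
Qed.

Lemma mspan_sub X Y x : (forall a, X a -> Y a) -> mspan X x -> mspan Y x.
Proof.
move=> XY; elim=> [|a {}x Xa _ IH]; first exact: mspan1.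
exact: mspan_cons (XY _ Xa) IH.
Qed.

(** Spans grow on the left; generalizing over a prefix [y] that satisfies [Q] gives the induction on
    the last letter. *)
Lemma mspan_rind X (Q : M -> Prop) : Q 1 ->
  (forall x a, mspan X x -> Q x -> X a -> Q (x * a)) -> forall x, mspan X x -> Q x.
Proof.
move=> Q1 QM x Xx.
suff H y : mspan X y -> Q y -> Q (y * x) by rewrite -[x]mul1g; apply: H => //; apply: mspan1.
elim: Xx y => {x} [|a x Xa _ IH] y Xy Qy; first by rewrite mulg1.
rewrite mulgA; apply: IH; last exact: QM.
by apply: mspan_mul => //; apply: mspan_gen.
Qed.

Lemma mspan_commute X x y :
  (forall a, X a -> commute a y) -> mspan X x -> commute x y.
Proof.
move=> Xy; elim=> [|a {}x Xa _ IH]; first exact/commute_sym/commute1.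
by apply/commute_sym/commuteM; apply/commute_sym => //; apply: Xy.
Qed.

Lemma expg_intertwine a b x e : a * x = x * b -> a ^+ e * x = x * b ^+ e.
Proof.
move=> ax; elim: e => [|e IH]; first by rewrite !expg0 mul1g mulg1.
by rewrite expgSr -mulgA ax mulgA IH -mulgA -expgSr.
Qed.

(* Products are kept nested to the right, so that a relation is used with a tail [x]. *)
Lemma mulg2 a b c : a * b = c -> forall x, a * (b * x) = c * x.
Proof. by move=> <- x; rewrite mulgA. Qed.

Lemma mulg3 a b c r : a * (b * c) = r -> forall x, a * (b * (c * x)) = r * x.
Proof. by move=> <- x; rewrite -!mulgA. Qed.

End Span.

(** Versions of [adjacent] and [far] on [nat]: below, letters have indices in [nat], so that the
    number of points can vary without casts. *)
Definition adj i j := (i.+1 == j) || (j.+1 == i).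
Definition distant i j := (i.+1 < j)%N || (j.+1 < i)%N.

(** The factor counts the positions in the two normal forms, [m.+1] and [m]. For [m = 0] truncated
    subtraction gives [dfact 0 = 1]. *)
Lemma dfact_step m : dfact (2 * m.+1 - 1) = ((m.+1 + m) * dfact (2 * m - 1))%N.
Proof.
case: m => [|m] //; rewrite (_ : 2 * m.+2 - 1 = (2 * m.+1 - 1).+2)%N; last lia.
rewrite [dfact _.+2]/=; congr (_ * _)%N; lia.
Qed.

(** * Normal forms in a monoid satisfying the framed Brauer relations *)

Section FramedRelations.
Local Open Scope group_scope.
Variables (M : monoidType) (d n : nat) (s t z : nat -> M).
Hypothesis d_gt0 : (0 < d)%N.
Local Notation ok i := (i.+1 < n)%N.
Hypothesis ss : forall i, ok i -> s i * s i = 1.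
Hypothesis ss_far : forall i j, ok i -> ok j -> distant i j -> s i * s j = s j * s i.
Hypothesis sss : forall i j, ok i -> ok j -> adj i j ->
  s i * (s j * s i) = s j * (s i * s j).
Hypothesis tt_far : forall i j, ok i -> ok j -> distant i j -> t i * t j = t j * t i.
Hypothesis ttt : forall i j, ok i -> ok j -> adj i j -> t i * (t j * t i) = t i.
Hypothesis ts : forall i, ok i -> t i * s i = t i.
Hypothesis st : forall i, ok i -> s i * t i = t i.
Hypothesis ts_far : forall i j, ok i -> ok j -> distant i j -> t i * s j = s j * t i.
Hypothesis stt : forall i j, ok i -> ok j -> adj i j ->
  s i * (t j * t i) = s j * t i.
Hypothesis tts : forall i j, ok i -> ok j -> adj i j ->
  t i * (t j * s i) = t i * s j.
Hypothesis zd : forall j, (j < n)%N -> z j ^+ d = 1.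
Hypothesis zz : forall i j, (i < n)%N -> (j < n)%N -> z i * z j = z j * z i.
Hypothesis zs_lo : forall i, ok i -> z i * s i = s i * z i.+1.
Hypothesis zs_hi : forall i, ok i -> z i.+1 * s i = s i * z i.
Hypothesis zs_far : forall i j, ok i -> (j < n)%N -> j != i -> j != i.+1 ->
  z j * s i = s i * z j.
Hypothesis tz : forall i, ok i -> t i * z i = t i * z i.+1.
Hypothesis zt : forall i, ok i -> z i * t i = z i.+1 * t i.
Hypothesis zt_far : forall i j, ok i -> (j < n)%N -> j != i -> j != i.+1 ->
  z j * t i = t i * z j.
Hypothesis tzt : forall i k, ok i -> t i * (z i ^+ k * t i) = t i.

Lemma tss i j : ok i -> ok j -> adj i j -> t i * (s j * s i) = t i * t j.
Proof.
by move=> oi oj ij; rewrite mulgA -(tts oi oj ij) -!mulgA ss // mulg1.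
Qed.

Lemma sst i j : ok i -> ok j -> adj i j -> s i * (s j * t i) = t j * t i.
Proof.
by move=> oi oj ij; rewrite -(stt oi oj ij) (mulg2 (ss oi)) mul1g.
Qed.

Lemma tst i j : ok i -> ok j -> adj i j -> t i * (s j * t i) = t i.
Proof.
by move=> oi oj ij; rewrite -(stt oi oj ij) (mulg2 (ts oi)) ttt.
Qed.

Lemma tzX i e : ok i -> t i * z i ^+ e = t i * z i.+1 ^+ e.
Proof.
move=> oi; elim: e => [|e IH]; first by rewrite !expg0.
rewrite expgSr mulgA IH -mulgA -(commuteX e (zz (ltnW oi) oi)) mulgA tz //.
by rewrite -mulgA -expgS.
Qed.

Lemma zXt i e : ok i -> z i ^+ e * t i = z i.+1 ^+ e * t i.
Proof.
move=> oi; elim: e => [|e IH]; first by rewrite !expg0.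
rewrite expgS -mulgA IH mulgA (commuteX e (zz (ltnW oi) oi)) -mulgA zt //.
by rewrite mulgA -expgSr.
Qed.

Lemma zXs_lo i e : ok i -> z i ^+ e * s i = s i * z i.+1 ^+ e.
Proof. by move=> oi; apply: expg_intertwine; apply: zs_lo. Qed.
Lemma zXs_hi i e : ok i -> z i.+1 ^+ e * s i = s i * z i ^+ e.
Proof. by move=> oi; apply: expg_intertwine; apply: zs_hi. Qed.
Lemma zXs_far i j e : ok i -> (j < n)%N -> j != i -> j != i.+1 ->
  z j ^+ e * s i = s i * z j ^+ e.
Proof. by move=> *; apply: expg_intertwine; apply: zs_far. Qed.
Lemma zXt_far i j e : ok i -> (j < n)%N -> j != i -> j != i.+1 ->
  z j ^+ e * t i = t i * z j ^+ e.
Proof. by move=> *; apply: expg_intertwine; apply: zt_far. Qed.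

Lemma zX_modn j e : (j < n)%N -> z j ^+ e = z j ^+ (e %% d).
Proof.
move=> jn; rewrite {1}(divn_eq e d) expgnDr mulnC expgnA zd // expg1n mul1g //.
Qed.

(** * Submonoids of words on the first m points *)

Inductive wreath_gen m : M -> Prop :=
| wreath_s i : (i.+1 < m)%N -> wreath_gen m (s i)
| wreath_z j : (j < m)%N -> wreath_gen m (z j).

Inductive brauer_gen m : M -> Prop :=
| brauer_wreath a : wreath_gen m a -> brauer_gen m a
| brauer_t i : (i.+1 < m)%N -> brauer_gen m (t i).

Local Notation G m := (mspan (wreath_gen m)).
Local Notation P m := (mspan (brauer_gen m)).

Lemma wreath_genW m m' a : (m <= m')%N -> wreath_gen m a -> wreath_gen m' a.
Proof. by move=> mm [i|j] H; constructor; apply: leq_trans mm. Qed.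
Lemma brauer_genW m m' a : (m <= m')%N -> brauer_gen m a -> brauer_gen m' a.
Proof.
move=> mm [{}a H|i H]; first exact/brauer_wreath/(wreath_genW mm).
by apply: brauer_t; apply: leq_trans mm.
Qed.

Lemma GW m m' x : (m <= m')%N -> G m x -> G m' x.
Proof. by move=> mm; apply: mspan_sub => a; apply: wreath_genW. Qed.
Lemma PW m m' x : (m <= m')%N -> P m x -> P m' x.
Proof. by move=> mm; apply: mspan_sub => a; apply: brauer_genW. Qed.
Lemma GP m x : G m x -> P m x.
Proof. by apply: mspan_sub => a; apply: brauer_wreath. Qed.

Lemma Gs m i : (i.+1 < m)%N -> G m (s i).
Proof. by move=> im; apply/mspan_gen/wreath_s. Qed.
Lemma Gz m j e : (j < m)%N -> G m (z j ^+ e).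
Proof. by move=> jm; apply/mspan_exp/mspan_gen/wreath_z. Qed.
Lemma Ps m i : (i.+1 < m)%N -> P m (s i).
Proof. by move=> im; apply/GP/Gs. Qed.
Lemma Pz m j e : (j < m)%N -> P m (z j ^+ e).
Proof. by move=> im; apply/GP/Gz. Qed.
Lemma Pt m i : (i.+1 < m)%N -> P m (t i).
Proof. by move=> im; apply/mspan_gen/brauer_t. Qed.

(** Letters of [P m] involve points below [m] only, so each is covered by a far commutation relation
    with [t i]. *)
Lemma commute_t m i x : (m <= i)%N -> ok i -> P m x -> commute x (t i).
Proof.
move=> mi oi; apply: mspan_commute => _ [_ [j jm|j jm]|j jm]; rewrite /commute.
- by rewrite ts_far //; rewrite /distant; lia.
- by rewrite zt_far //; lia.
- by rewrite tt_far //; rewrite /distant; lia.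
Qed.

Lemma commute_s m i x : (m <= i)%N -> ok i -> P m x -> commute x (s i).
Proof.
move=> mi oi; apply: mspan_commute => _ [_ [j jm|j jm]|j jm]; rewrite /commute.
- by rewrite ss_far //; rewrite /distant; lia.
- by rewrite zs_far //; lia.
- by rewrite ts_far //; rewrite /distant; lia.
Qed.

Lemma commute_z m i x e : (m <= i)%N -> (i < n)%N -> P m x -> commute x (z i ^+ e).
Proof.
move=> mi oi xP; apply: commuteX.
apply: mspan_commute xP => _ [_ [j jm|j jm]|j jm]; rewrite /commute.
- by rewrite zs_far //; lia.
- by rewrite zz //; lia.
- by rewrite zt_far //; lia.
Qed.

(* [dn m k] is s_(m-1) ... s_k and [up m k] is s_k ... s_(m-1), both 1 for [m <= k]. *)
Fixpoint dn m k : M :=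
  if m is m'.+1 then if (k <= m')%N then s m' * dn m' k else 1 else 1.
Fixpoint up m k : M :=
  if m is m'.+1 then if (k <= m')%N then up m' k * s m' else 1 else 1.

Lemma dnS m k : (k <= m)%N -> dn m.+1 k = s m * dn m k.
Proof. by move=> km /=; rewrite km. Qed.
Lemma upS m k : (k <= m)%N -> up m.+1 k = up m k * s m.
Proof. by move=> km /=; rewrite km. Qed.
Lemma dnn m : dn m m = 1.
Proof. by case: m => //= m; rewrite ltnn. Qed.
Lemma upp m : up m m = 1.
Proof. by case: m => //= m; rewrite ltnn. Qed.

Lemma G_dn m k : G m.+1 (dn m k).
Proof.
elim: m => [|m IH] /=; first exact: mspan1.
case: ifP => _; last exact: mspan1.
apply: mspan_mul; first exact: Gs.
exact: GW IH.
Qed.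
Lemma G_up m k : G m.+1 (up m k).
Proof.
elim: m => [|m IH] /=; first exact: mspan1.
case: ifP => _; last exact: mspan1.
apply: mspan_mul; last exact: Gs.
exact: GW IH.
Qed.

Lemma up_dn m k : (m < n)%N -> up m k * dn m k = 1.
Proof.
elim: m => [|m IH] mn /=; first by rewrite mul1g.
case: ifP => _; last by rewrite mul1g.
by rewrite -mulgA (mulg2 (ss mn)) mul1g IH // ltnW.
Qed.

(** The factors [s i * s i.-1] of [dn m k] meet [s i] in a braid relation; all other factors commute
    past. *)
Lemma dn_s m k i : (m < n)%N -> (k < i)%N -> (i < m)%N ->
  dn m k * s i = s i.-1 * dn m k.
Proof.
elim: m => // m IH mn ki im; rewrite !dnS; try lia.
have [im'|] := ltnP i m.
  rewrite -mulgA IH; try lia; rewrite !mulgA ss_far //; try lia.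
  by rewrite /distant; lia.
move=> mi; have E : i = m by lia.
subst i; case: m {IH mi} im mn ki => // m im mn ki.
rewrite dnS; last by lia.
rewrite -!mulgA.
have -> : dn m k * s m.+1 = s m.+1 * dn m k.
  by apply: (@commute_s m.+1) => //; apply/GP/G_dn.
rewrite !mulgA; congr (_ * _); rewrite -!mulgA /=.
by rewrite sss //; rewrite /adj; lia.
Qed.

Lemma dn_s_lt m k i : (m < n)%N -> (i.+1 < k)%N -> (k <= m)%N ->
  dn m k * s i = s i * dn m k.
Proof.
elim: m => [|m IH] mn ik km; first lia.
have [km'|E] := leqP k m; last first.
  have -> : k = m.+1 by lia.
  by rewrite dnn mul1g mulg1.
rewrite dnS // -mulgA IH; try lia.
by rewrite !mulgA ss_far //; rewrite /distant; lia.
Qed.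

Lemma dn_step m k : (k < m)%N -> dn m k = dn m k.+1 * s k.
Proof.
elim: m => // m IH; rewrite ltnS leq_eqVlt => /orP[/eqP->|km].
  by rewrite dnS // !dnn mulg1 mul1g.
by rewrite !dnS // ?(ltnW km) // IH // mulgA.
Qed.

(** The strand of [dn m k] ending at bottom [k] starts at top [m], and its bead slides along it. In
    the next two lemmas, strands to its right shift by one and those to its left are vertical. *)
Lemma dn_z_eq m k : (m < n)%N -> (k <= m)%N -> dn m k * z k = z m * dn m k.
Proof.
elim: m => [|m IH] mn; first by rewrite leqn0 => /eqP-> /=; rewrite mul1g mulg1.
rewrite leq_eqVlt => /orP[/eqP->|km]; first by rewrite dnn mul1g mulg1.
by rewrite dnS // -mulgA IH // ?(ltnW mn) // !mulgA zs_hi.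
Qed.

Lemma dn_z_gt m k j : (m < n)%N -> (k < j)%N -> (j <= m)%N ->
  dn m k * z j = z j.-1 * dn m k.
Proof.
elim: m => [|m IH] mn kj jm; first lia.
rewrite dnS -?mulgA; last lia.
move: jm; rewrite leq_eqVlt => /orP[/eqP E|jm].
  rewrite {}E in kj *; rewrite (commuteX 1 (commute_z 1 _ mn (GP (G_dn m k)))) //.
  by rewrite expg1 !mulgA zs_lo.
by rewrite IH ?(ltnW mn) // !mulgA zs_far //; lia.
Qed.

Lemma dn_z_lt m k j : (m < n)%N -> (j < k)%N -> (k <= m)%N ->
  dn m k * z j = z j * dn m k.
Proof.
elim: m => [|m IH] mn jk km; first lia.
have [km'|E] := leqP k m; last first.
  have -> : k = m.+1 by lia.
  by rewrite dnn mul1g mulg1.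
by rewrite dnS // -mulgA IH ?(ltnW mn) // !mulgA zs_far //; lia.
Qed.

(* Cosets of the wreath product Z/d wr S_m in Z/d wr S_(m+1). *)
Lemma G_decomp m x : (m < n)%N -> G m.+1 x ->
  exists g e k, [/\ G m g, (k <= m)%N & x = g * (z m ^+ e * dn m k)].
Proof.
move=> mn; move: x; apply: mspan_rind.
  exists 1, 0%N, m; split=> //; first exact: mspan1.
  by rewrite expg0 dnn !mulg1.
move=> _ a _ [g [e [k [Gg km ->]]]] [i im|j jm]; rewrite -!mulgA.
  (* The letter [s i] shortens [dn m k] if [i = k], lengthens it if [i.+1 = k], and otherwise passes
     through to [g]. *)
  have [ik|ki|<-] := ltngtP i k; last first.
  - exists g, e, i.+1; split=> //.
    by rewrite (@dn_step m i im) -mulgA ss ?mulg1 //; lia.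
  - exists (g * s i.-1), e, k; split=> //.
      by apply: mspan_mul => //; apply: Gs; lia.
    rewrite dn_s //.
    by rewrite -mulgA; congr (_ * _); rewrite !mulgA zXs_far //; lia.
  move: ik; rewrite leq_eqVlt => /orP[/eqP ik|ik].
    by exists g, e, i; split=> //; [lia | rewrite (@dn_step m i im) ik].
  exists (g * s i), e, k; split=> //.
    by apply: mspan_mul => //; apply: Gs; lia.
  rewrite dn_s_lt //.
  by rewrite -mulgA; congr (_ * _); rewrite !mulgA zXs_far //; lia.
have zC i : (i < m)%N -> z m ^+ e * (z i * dn m k) = z i * (z m ^+ e * dn m k).
  move=> im; rewrite !mulgA; congr (_ * _).
  by apply/commute_sym/commuteX/zz; lia.
have GM i : (i < m)%N -> G m (g * z i).
  by move=> im; apply: mspan_mul => //; apply/mspan_gen/wreath_z.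
have [jk|kj|->] := ltngtP j k.
- exists (g * z j), e, k; split=> //; first by apply: GM; lia.
  by rewrite dn_z_lt // zC -?mulgA //; lia.
- exists (g * z j.-1), e, k; split=> //; first by apply: GM; lia.
  by rewrite dn_z_gt // zC -?mulgA //; lia.
- exists g, e.+1, k; split=> //.
  by rewrite dn_z_eq // expgSr -!mulgA.
Qed.

Lemma G_inv m x : (m <= n)%N -> G m x -> exists y, [/\ G m y, x * y = 1 & y * x = 1].
Proof.
move=> mn; elim=> [|a {}x Ga _ [y [Gy xy yx]]].
  by exists 1; rewrite mulg1; split=> //; apply: mspan1.
suff [b [Gb ab ba]] : exists b, [/\ G m b, a * b = 1 & b * a = 1].
  exists (y * b); split; first exact: mspan_mul.
    by rewrite -mulgA (mulg2 xy) mul1g.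
  by rewrite -mulgA (mulg2 ba) mul1g.
case: Ga => [i im|j jm].
  by exists (s i); rewrite ss; [split=> //; apply: Gs | lia].
have zdj : z j ^+ d = 1 by apply: zd; lia.
exists (z j ^+ d.-1); split; first exact: Gz.
  by rewrite -expgS prednK.
by rewrite -expgSr prednK.
Qed.

(** Mirror image of [G_decomp], by decomposing the inverse of [x]: [up] inverts [dn], and [e * d.-1]
    is congruent to [-e] modulo [d]. *)
Lemma G_decompV m x : (m < n)%N -> G m.+1 x ->
  exists g e k, [/\ G m g, (k <= m)%N & x = up m k * (z m ^+ e * g)].
Proof.
move=> mn Gx; have [y [Gy xy yx]] := G_inv mn Gx.
have [g [e [k [Gg km Ey]]]] := G_decomp mn Gy.
have [h [Gh gh hg]] := G_inv (ltnW mn) Gg.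
exists h, (e * d.-1)%N, k; split=> //.
have zK : z m ^+ (e * d.-1) * z m ^+ e = 1.
  rewrite -expgnDr addnC -mulnS prednK // mulnC expgnA zd // expg1n //.
set v := RHS; have vy : v * y = 1.
  by rewrite /v Ey -!mulgA (mulg2 hg) mul1g (mulg2 zK) mul1g up_dn.
by rewrite -[LHS]mul1g -vy -mulgA yx mulg1.
Qed.

(** * Normal forms by induction on the number of points *)

Inductive nf m : M -> Prop :=
| nf_dn a e k : P m a -> (k <= m)%N -> nf m (a * (z m ^+ e * dn m k))
| nf_up p j e y : m = p.+1 -> (j <= p)%N -> P m y ->
    nf m (up p j * (z p ^+ e * (t p * y))).

Lemma nf_G m x : (m < n)%N -> G m.+1 x -> nf m x.
Proof.
by move=> mn /(G_decomp mn)[g [e [k [/GP Pg km ->]]]]; apply: nf_dn.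
Qed.

(** The part of [g] on the first [m] points commutes with [t m] and is absorbed into [y]. *)
Lemma Gt_up m g y : ok m -> G m.+1 g -> P m.+1 y -> nf m.+1 (g * (t m * y)).
Proof.
move=> om Gg Py; have [h [e [k [Gh km ->]]]] := G_decompV (ltnW om) Gg.
rewrite -!mulgA (mulg2 (commute_t (leqnn m) om (GP Gh))) -mulgA.
apply: nf_up => //; apply: mspan_mul => //.
exact: PW (GP Gh).
Qed.

Lemma dn_G p k : (k < p)%N -> exists2 b, P p b & dn p k = s p.-1 * b.
Proof.
case: p => // p kp; exists (dn p k); first exact/GP/G_dn.
by rewrite dnS.
Qed.

(** A weakening of [nf] whose outer factors lie in [P m] and hence commute with [t m], leaving a
    short word in the middle. *)
Variant middle m : M -> Prop :=
| middle_z a e : P m a -> middle m (a * z m ^+ e)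
| middle_s p a e b : m = p.+1 -> P m a -> P m b ->
    middle m (a * (z m ^+ e * (s p * b)))
| middle_t p a b : m = p.+1 -> P m a -> P m b -> middle m (a * (t p * b)).

Lemma nf_middle m x : (m < n)%N -> nf m x -> middle m x.
Proof.
move=> mn [a e k Pa km|p j e y Em jp Py]; last first.
  rewrite !mulgA -(mulgA _ (t p)); apply: middle_t => //.
  apply: mspan_mul; last by apply: Pz; rewrite Em.
  by rewrite Em; apply/GP/G_up.
move: km; rewrite leq_eqVlt => /orP[/eqP->|km].
  by rewrite dnn mulg1; apply: middle_z.
have [b Pb ->] := dn_G km.
by apply: middle_s => //; rewrite prednK //; apply: leq_ltn_trans km.
Qed.

(** A letter outside [P m.+1] is [s m], [z m.+1] or [t m]. In the first and last cases the outer
    factors of the [middle] form move aside, and a relation for [t m], the middle word and the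
    letter removes that letter. *)
Lemma t_absorb m : ok m -> (forall x, P m.+1 x -> middle m x) ->
  forall x, P m.+2 x -> exists2 y, P m.+1 y & t m * x = t m * y.
Proof.
move=> om IH; apply: mspan_rind; first by exists 1; first exact: mspan1.
move=> x a _ [y Py E] Xa; rewrite mulgA E {x E}.
suff [y' Py' E] : exists2 y', P m.+1 y' & t m * (y * a) = t m * y'.
  by exists y'; rewrite -?mulgA.
have done_ b : P m.+1 b -> a = b -> exists2 y', P m.+1 y' & t m * (y * a) = t m * y'.
  by move=> Pb ->; exists (y * b) => //; apply: mspan_mul.
have Ct b : P m b -> t m * b = b * t m.
  by move=> Pb; rewrite (commute_t (leqnn m) om Pb).
have C3 b c : P m b -> t m * (b * c) = b * (t m * c).
  by move=> Pb; rewrite !mulgA Ct.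
case: Xa done_ => [_ [i im|j jm]|i im] done_.
- have [im'|] := ltnP i m; first exact: done_ (Ps _) erefl.
  move=> mi; have {i im mi done_}-> : i = m by lia.
  have:= IH y Py; case=> {y Py} [b e Pb|p b e c Em Pb Pc|p b c Em Pb Pc].
  + exists (b * z m ^+ e); first by apply: mspan_mul; [apply: PW Pb | apply: Pz].
    rewrite -mulgA !(C3 b) // zXs_lo // (mulg2 (ts om)) tzX //.
  (* Once the beads have slid through [s p], the witness comes from
     [t m * (s p * s m) = t m * t p]. *)
  + exists (b * (t p * (z p ^+ e * c))).
      apply: mspan_mul; first exact: PW Pb.
      apply: mspan_mul; first by apply: Pt; lia.
      by apply: mspan_mul; [apply: Pz; lia | exact: PW Pc].
    have op : ok p by lia.
    have pm : adj m p by rewrite /adj; lia.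
    rewrite -!mulgA !(C3 b) //; congr (_ * _).
    have -> : c * s m = s m * c by apply: commute_s Pc => //.
    rewrite Em (mulg2 (zXs_hi _ op)) -!mulgA.
    rewrite -[p.+1]Em.
    have -> : z p ^+ e * (s m * c) = s m * (z p ^+ e * c).
      by rewrite mulgA zXs_far ?mulgA //; lia.
    by rewrite (mulg3 (tss om op pm)) -!mulgA.
  + have op : ok p by lia.
    have pm : adj m p by rewrite /adj; lia.
    exists (b * (s p * c)).
      by apply: mspan_mul; [exact: PW Pb | apply: mspan_mul; [apply: Ps; lia | exact: PW Pc]].
    rewrite -!mulgA !(C3 b) //; congr (_ * _).
    have -> : c * s m = s m * c by apply: commute_s Pc => //.
    by rewrite (mulg3 (tts om op pm)) -!mulgA.
- have [jm'|] := ltnP j m.+1; first by apply: done_ erefl; rewrite -[z j]expg1; apply: Pz.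
  move=> mj; have {j jm mj done_}-> : j = m.+1 by lia.
  exists (z m * y); first by apply: mspan_mul => //; rewrite -[z m]expg1; apply: Pz.
  have -> : y * z m.+1 = z m.+1 * y by have := @commute_z m.+1 m.+1 y 1; rewrite expg1; apply.
  by rewrite !mulgA tz.
- have [im'|] := ltnP i m; first exact: done_ (Pt _) erefl.
  move=> mi; have {i im mi done_}-> : i = m by lia.
  have:= IH y Py; case=> {y Py} [b e Pb|p b e c Em Pb Pc|p b c Em Pb Pc].
  + exists b; first exact: PW Pb.
    by rewrite -mulgA (C3 b) // tzt // Ct.
  + exists (b * (z p ^+ e * c)).
      apply: mspan_mul; [exact: PW Pb | apply: mspan_mul; [apply: Pz; lia | exact: PW Pc]].
    have op : ok p by lia.
    have pm : adj m p by rewrite /adj; lia.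
    rewrite -!mulgA !(C3 b) //; congr (_ * _).
    have -> : c * t m = t m * c by apply: commute_t Pc => //.
    rewrite Em (mulg2 (zXs_hi _ op)) -!mulgA.
    rewrite -[p.+1]Em.
    have -> : z p ^+ e * (t m * c) = t m * (z p ^+ e * c).
      by rewrite mulgA zXt_far ?mulgA //; lia.
    by rewrite (mulg3 (tst om op pm)).
  + have op : ok p by lia.
    have pm : adj m p by rewrite /adj; lia.
    exists (b * c); first by apply: mspan_mul; [exact: PW Pb | exact: PW Pc].
    rewrite -!mulgA !(C3 b) //; congr (_ * _).
    have -> : c * t m = t m * c by apply: commute_t Pc => //.
    by rewrite (mulg3 (ttt om op pm)).
Qed.

(** Iterates the conjugation [t m = s m.+1 * s m * t m.+1 * s m * s m.+1]. *)
Lemma t_conj m i : ok m -> (i <= m)%N ->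
  exists g h, [/\ G m.+2 g, G m.+2 h & t i = g * (t m * h)].
Proof.
move=> om; rewrite leq_eqVlt => /orP[/eqP->|].
  by exists 1, 1; rewrite mul1g mulg1; split=> //; apply: mspan1.
elim: m om => // m IH om; rewrite ltnS => im.
have [g [h [Gg Gh ->]]] : exists g h, [/\ G m.+2 g, G m.+2 h & t i = g * (t m * h)].
  move: im; rewrite leq_eqVlt => /orP[/eqP->|im]; last by apply: IH => //; lia.
  by exists 1, 1; rewrite mul1g mulg1; split=> //; apply: mspan1.
have Gsm : G m.+3 (s m) by apply: Gs; lia.
have Gsm1 : G m.+3 (s m.+1) by apply: Gs; lia.
exists (g * (s m.+1 * s m)), (s m * (s m.+1 * h)); split.
- by apply: mspan_mul; [exact: GW Gg | apply: mspan_mul].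
- by apply: mspan_mul => //; apply: mspan_mul => //; exact: GW Gh.
have om' : ok m by lia.
have a1 : adj m.+1 m by rewrite /adj eqxx orbT.
have a2 : adj m m.+1 by rewrite /adj eqxx.
rewrite -!mulgA (mulg3 (sst om om' a1)) -!mulgA; congr (_ * _).
rewrite (mulgA (t m) (t m.+1)) -(tss om' om a2) -!mulgA.
by rewrite (mulg2 (ss om')) mul1g (mulg2 (ss om)) mul1g.
Qed.

(** A new leading letter [t i] becomes [g * (t m * h)] by [t_conj], and [t_absorb] shrinks
    everything after [t m] to [P m.+1]. *)
Lemma P_wreath_t m x : ok m -> (forall y, P m.+1 y -> middle m y) -> P m.+2 x ->
  G m.+2 x \/ exists g y, [/\ G m.+2 g, P m.+1 y & x = g * (t m * y)].
Proof.
move=> om IH; elim=> [|_ {}x [a Ga|i im] Px IHx]; first by left; apply: mspan1.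
  case: IHx => [Gx|[g [y [Gg Py ->]]]]; first by left; apply: mspan_cons.
  by right; exists (a * g), y; rewrite mulgA; split=> //; apply: mspan_cons.
right; have [g [h [Gg Gh ->]]] := t_conj om (im : (i <= m)%N).
have [y Py E] : exists2 y, P m.+1 y & t m * (h * x) = t m * y.
  by apply: t_absorb => //; apply: mspan_mul => //; apply: GP.
by exists g, y; rewrite -!mulgA E.
Qed.

(** This is the product of short words left over in [nf_step]; it is treated according to the normal
    form of [y]. *)
Lemma nf_ts p x y : ok p.+1 -> (forall y, P p.+2 y -> nf p.+1 y) ->
   G p.+2 x -> P p.+2 y -> nf p.+2 (x * (t p * (s p.+1 * y))).
Proof.
move=> om IH Gx /IH; have op : ok p by lia.
have pm : adj p p.+1 by rewrite /adj eqxx.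
have mp : adj p.+1 p by rewrite /adj eqxx orbT.
have Ptp : P p.+2 (t p) by apply: Pt.
case=> {y} [Y f k PY km|_ j f Y [<-] jp PY].
  (* The crossing [s p.+1] passes [Y], moves the beads to strand [p.+2] and becomes the first factor
     of [dn p.+2 k]. *)
  rewrite (mulg2 (esym (commute_s (leqnn _) om PY))) -mulgA.
  rewrite (mulg2 (esym (zXs_hi f om))) -mulgA -dnS // (mulgA (t p)) (mulgA x).
  apply: nf_dn; last lia.
  apply: mspan_mul; first exact: GP.
  by apply: mspan_mul => //; apply: PW PY.
move: jp; rewrite leq_eqVlt => /orP[/eqP->|jp].
  (* The beads are carried to strand [p.+2], out of the way of [t p * (s p.+1 * t p) = t p]. *)
  rewrite upp mul1g (mulg2 (zXt f op)) -!mulgA.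
  rewrite (mulgA (s p.+1)) -(zXs_hi f om) -!mulgA.
  rewrite (mulgA (t p)) -zXt_far; [|done..|lia|lia].
  rewrite -!mulgA (mulg3 (tst op om pm)).
  have PtY : P p.+2 (t p * Y) by apply: mspan_mul => //; apply: PW PY.
  rewrite -(commute_z f (leqnn _) om PtY) -(mulg1 (z _ ^+ f)) -(dnn p.+2) mulgA.
  by apply: nf_dn => //; apply: mspan_mul => //; apply: GP.
case: p => // q in om IH Gx op pm mp Ptp PY jp *.
have oq : ok q by lia.
have qp : adj q q.+1 by rewrite /adj eqxx.
have pq : adj q.+1 q by rewrite /adj eqxx orbT.
have far : distant q.+2 q by rewrite /distant; lia.
have Pup : P q.+1 (up q j) by apply/GP/G_up.
rewrite upS -?mulgA; last lia.
have E : s q * (z q.+1 ^+ f * (t q.+1 * Y)) = z q ^+ f * (s q * (t q.+1 * Y)).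
  by rewrite (mulg2 (esym (zXs_lo f oq))) -!mulgA.
rewrite {}E.
have Pu : P q.+1 (up q j * z q ^+ f) by apply: mspan_mul => //; apply: Pz.
rewrite (mulgA (up q j)) (mulg2 (esym (commute_s _ om Pu))) -?(mulgA _ (s q.+2)); last lia.
rewrite (mulg2 (esym (commute_t (leqnn _) op Pu))) -mulgA.
(* The word [t q.+1 * s q.+2 * s q * t q.+1] turns into [s q * s q.+1 * t q.+2 * t q * t q.+1], to
   which [Gt_up] applies. *)
rewrite [s q.+2 * _](mulg2 (ss_far om oq far)) -!mulgA.
rewrite (mulgA (s q.+2)) -(stt op om pm) -!mulgA.
rewrite (mulg3 (tss op oq pq)) -!mulgA (mulgA (t q.+1)) -(sst oq op qp) -!mulgA.
rewrite (mulgA (t q)) -(tt_far om oq far) -!mulgA (mulgA (s q)).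
rewrite (mulgA _ (_ * _)) (mulgA _ (_ * _)) (mulgA _ (_ * _ )).
apply: Gt_up => //.
  have Gsq : G q.+3 (s q) by apply: Gs; lia.
  have Gsq1 : G q.+3 (s q.+1) by apply: Gs; lia.
  apply: mspan_mul => //; apply: mspan_mul; first by apply: GW (G_up q j); lia.
  by apply: mspan_mul; [apply: Gz; lia | apply: mspan_mul].
apply: mspan_mul; first by apply: Pt; lia.
by apply: mspan_mul => //; apply: PW PY.
Qed.

(** In [g * (t m * y)] the coset representative of [g] is trivial, or is [s m] and absorbed by
    [t m], or starts with [s m * s m.-1]; then [s m * s m.-1 * t m = t m.-1 * s m * s m.-1] leads to
    [nf_ts]. *)
Lemma nf_step m x : ok m -> (forall y, P m.+1 y -> nf m y) -> P m.+2 x -> nf m.+1 x.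
Proof.
move=> om IH Px; have IH3 y : P m.+1 y -> middle m y.
  by move=> /IH; apply: nf_middle; apply: ltnW.
have [Gx|[g [y [Gg Py ->]]]] := P_wreath_t om IH3 Px; first exact: nf_G.
have [h [e [k [Gh km ->]]]] := G_decomp om Gg; rewrite -!mulgA.
have Gzt w : P m.+1 w -> nf m.+1 (h * (z m.+1 ^+ e * (t m * w))).
  move=> Pw; rewrite (mulgA _ (t m)) -zXt // -(mulgA (z m ^+ e)) (mulgA h); apply: Gt_up => //.
  by apply: mspan_mul => //; apply: Gz.
move: km; rewrite leq_eqVlt => /orP[/eqP->|]; first by rewrite dnn mul1g; apply: Gzt.
rewrite ltnS leq_eqVlt => /orP[/eqP->|].
  by rewrite dnS // dnn mulg1 (mulg2 (st om)); apply: Gzt.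
case: m => // p in om IH Px IH3 Gg Gh Py Gzt *; rewrite ltnS => km.
have op : ok p by lia.
have pm : adj p p.+1 by rewrite /adj eqxx.
have mp : adj p.+1 p by rewrite /adj eqxx orbT.
rewrite !dnS // -?mulgA; last lia.
rewrite (mulg2 (commute_t (leqnn _) om (GP (G_dn p k)))) -mulgA.
rewrite (mulg3 (sst om op mp)) -(tss op om pm) -!mulgA.
rewrite (mulgA _ (t p)) zXt_far; [|done..|lia|lia].
rewrite -!mulgA (mulg2 (zXs_hi e om)) -!mulgA.
apply: nf_ts => //; apply: mspan_mul; first exact: Pz.
apply: mspan_mul; first exact: Ps.
by apply: mspan_mul => //; apply: PW (GP (G_dn p k)).
Qed.

Theorem P_nf m x : (m < n)%N -> P m.+1 x -> nf m x.
Proof.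
elim: m x => [|m IH] x mn Px; last first.
  by apply: nf_step Px => // y; apply/IH/ltnW.
(* On one point there are no letters [s] or [t], so [P 1] is [G 1]. *)
apply: nf_G => //; elim: Px => [|_ {}x [a Ga|//] _ IHx]; first exact: mspan1.
exact: mspan_cons.
Qed.

(** Each element of [L] yields [(m.+1 + m) * d] entries. For [m = 0] the second list is empty, so
    [m.-1] is harmless. *)
Definition nf_next m (L : seq M) : seq M :=
  [seq p.1.2 * (z m ^+ p.1.1 * dn m p.2)
     | p <- allpairs pair (allpairs pair (iota 0 d) L) (iota 0 m.+1)] ++
  [seq up m.-1 p.2 * (z m.-1 ^+ p.1.1 * (t m.-1 * p.1.2))
     | p <- allpairs pair (allpairs pair (iota 0 d) L) (iota 0 m)].

Fixpoint nf_list m : seq M := if m is m'.+1 then nf_next m' (nf_list m') else [:: 1].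

Lemma size_nf_list m : size (nf_list m) = (dfact (2 * m - 1) * d ^ m)%N.
Proof.
elim: m => // m IH; rewrite /= size_cat !size_map !size_allpairs !size_iota IH.
by rewrite dfact_step expnS; lia.
Qed.

Lemma mem_nf_list m x : (m <= n)%N -> P m x -> x \in nf_list m.
Proof.
elim: m x => [|m IH] x mn Px.
  rewrite /= inE; apply/eqP; elim: Px => // _ {}x [_ [i|j]|i] //.
case: (P_nf mn Px) => [a e k Pa km|p j e y Em jp Py]; rewrite mem_cat; apply/orP.
  left; apply/mapP; exists (e %% d, a, k); last by rewrite /= -zX_modn.
  apply/allpairsP; exists (e %% d, a, k); rewrite mem_iota; split=> //=.
  by apply/allpairsP; exists (e %% d, a); rewrite mem_iota /= ltn_mod d_gt0 IH // ltnW.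
right; apply/mapP; exists (e %% d, y, j); last by rewrite Em /= -zX_modn //; lia.
apply/allpairsP; exists (e %% d, y, j); rewrite mem_iota; split=> //=; last by lia.
by apply/allpairsP; exists (e %% d, y); rewrite mem_iota /= ltn_mod d_gt0 IH // ltnW.
Qed.

End FramedRelations.

(** * Diagrams under left multiplication *)

(** Operator identities are settled by cases: [split_eq] splits equality tests, innermost first, and
    tries to close each branch by [congruence] from the facts recorded by [arc]. *)
Local Ltac no_if e :=
  lazymatch e with context [if _ then _ else _] => fail | _ => idtac end.
Local Ltac split_eq := repeat
  (match goal with |- context [@eq_op ?T ?a ?b] =>
     no_if a; no_if b; case: (@eqP T a b) => /= ? end; try congruence).
Local Ltac arc D x :=
  let K := fresh in let N := fresh in let B := fresh in
  have K := partnerK D x; have /eqP N := partner_neq D x;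
  have B := beads_partner D x.

Section Operators.
Variables d n : nat.
Local Notation point := (Defs.point n).
Local Notation bead := (bead d).
Local Notation abacus := (abacus d n).
Implicit Types (D E : abacus) (u v w x y : point) (b : bead).

Section Relabel.
Variables (u v : point) (D : abacus).
Let f x := tperm u v (partner D (tperm u v x)).
Let g x := beads D (tperm u v x).
Fact relabelK : involutive f.
Proof. by move=> x; rewrite /f tpermK partnerK tpermK. Qed.
Fact relabel_neq x : f x != x.
Proof.
apply/eqP=> E; have := partner_neq D (tperm u v x).
by rewrite -{2}E /f tpermK eqxx.
Qed.
Fact relabel_beads x : g (f x) = g x.
Proof. by rewrite /g /f tpermK beads_partner. Qed.
Definition relabel := mk_abacus relabelK relabel_neq relabel_beads.
End Relabel.

Section Join.
Variables (u v : point) (D : abacus).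
Local Notation f := (partner D).
Local Notation g := (beads D).
(* For [u = v] nothing is joined, so that the result is always a diagram. *)
Definition join_partner x : point :=
  if u == v then f x else if x == u then v else if x == v then u else
  if f x == u then f v else if f x == v then f u else f x.
(** The arcs at [u] and [v] merge and their beads add up. If they are one arc, it closes to a loop
    and its beads disappear. *)
Definition join_beads x : bead :=
  if u == v then g x else if (x == u) || (x == v) then 0%R else
  if f x == u then (g x + g v)%R else if f x == v then (g x + g u)%R else g x.

Fact join_partnerK : involutive join_partner.
Proof.
by move=> x; rewrite /join_partner; arc D x; arc D u; arc D v; split_eq.
Qed.
Fact join_partner_neq x : join_partner x != x.
Proof.
by rewrite /join_partner; arc D x; arc D u; arc D v; apply/eqP; split_eq.
Qed.
Fact join_beads_partner x : join_beads (join_partner x) = join_beads x.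
Proof.
rewrite /join_partner /join_beads; arc D x; arc D u; arc D v; split_eq;
  by rewrite addrC; congr (_ + _)%R; congruence.
Qed.
Definition join := mk_abacus join_partnerK join_partner_neq join_beads_partner.
End Join.

Section AddBeads.
Variables (b : bead) (u : point) (D : abacus).
Definition add_beads_at x : bead :=
  (beads D x + if (x == u) || (partner D x == u) then b else 0)%R.
Fact add_beads_partner x : add_beads_at (partner D x) = add_beads_at x.
Proof. by rewrite /add_beads_at beads_partner partnerK orbC. Qed.
Definition add_beads :=
  mk_abacus (partnerK D) (partner_neq D) add_beads_partner.
End AddBeads.

Lemma partner_relabel u v D x :
  partner (relabel u v D) x = tperm u v (partner D (tperm u v x)).
Proof. exact: partner_mk. Qed.
Lemma beads_relabel u v D x : beads (relabel u v D) x = beads D (tperm u v x).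
Proof. exact: beads_mk. Qed.
Lemma partner_join u v D x : partner (join u v D) x = join_partner u v D x.
Proof. exact: partner_mk. Qed.
Lemma beads_join u v D x : beads (join u v D) x = join_beads u v D x.
Proof. exact: beads_mk. Qed.
Lemma partner_add_beads b u D x : partner (add_beads b u D) x = partner D x.
Proof. exact: partner_mk. Qed.
Lemma beads_add_beads b u D x : beads (add_beads b u D) x =
  (beads D x + if (x == u) || (partner D x == u) then b else 0)%R.
Proof. exact: beads_mk. Qed.

Definition opE := (partner_relabel, beads_relabel, partner_join, beads_join,
  partner_add_beads, beads_add_beads).

(** * Identities between the operators *)

Lemma relabelC u v D : relabel u v D = relabel v u D.
Proof. by apply: abacus_ext => x; rewrite !opE tpermC. Qed.

(** Conjugation in the symmetric group. With [relabel_join] and [relabel_add_beads] it moves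
    exchanges past every operator. *)
Lemma relabel_relabel u v x y D : relabel u v (relabel x y D) =
  relabel (tperm u v x) (tperm u v y) (relabel u v D).
Proof.
have E z : tperm (tperm u v x) (tperm u v y) z = tperm u v (tperm x y (tperm u v z)).
  by rewrite (inj_tperm _ _ _ (@perm_inj _ (tperm u v))) tpermK.
by apply: abacus_ext => z; rewrite !opE !E !tpermK.
Qed.

Lemma relabelKK u v D : relabel u v (relabel u v D) = D.
Proof. by apply: abacus_ext => x; rewrite !opE !tpermK. Qed.

Lemma relabel_id u v D : partner D u = v -> relabel u v D = D.
Proof.
move=> Du; apply: abacus_ext => x; rewrite !opE.
by rewrite !permE /=; arc D x; arc D u; arc D v; split; split_eq.
Qed.

Lemma relabel_join u v x y D : relabel u v (join x y D) =
  join (tperm u v x) (tperm u v y) (relabel u v D).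
Proof.
apply: abacus_ext => z; rewrite -[z](tpermK u v); move: (tperm u v z) => {}z.
rewrite !opE /join_partner /join_beads !opE !tpermK !(inj_eq perm_inj).
by split; do ![case: ifP => // _].
Qed.

Lemma relabel_add_beads u v b x D :
  relabel u v (add_beads b x D) = add_beads b (tperm u v x) (relabel u v D).
Proof.
apply: abacus_ext => z; rewrite !opE.
by rewrite (inj_eq perm_inj) (can2_eq (tpermK u v) (tpermK u v)).
Qed.

Lemma joinC u v D : join u v D = join v u D.
Proof.
apply: abacus_ext => x; rewrite !opE /join_partner /join_beads.
by arc D x; arc D u; arc D v; split; split_eq.
Qed.

(** Merging the bead-free arc from [u] to [w] with the arc at [v] moves an end of the latter from
    [v] to [w], while [u] becomes linked to [v]. *)
Lemma join_arc u v w E : partner E u = w -> beads E u = 0%R -> u != v -> v != w ->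
  join u v E = relabel v w E.
Proof.
move=> Eu gu /eqP uv /eqP vw; apply: abacus_ext => x.
rewrite !opE /join_partner /join_beads !permE /=.
arc E x; arc E u; arc E v; arc E w; split; split_eq; last by rewrite gu addr0.
have -> : beads E x = 0%R by congruence.
by rewrite add0r; congruence.
Qed.

Lemma join_id u v E : partner E u = v -> beads E u = 0%R -> join u v E = E.
Proof.
move=> Eu gu; apply: abacus_ext => x; rewrite !opE /join_partner /join_beads.
by arc E x; arc E u; arc E v; split; split_eq.
Qed.

Lemma join_join_far u v x y D : uniq [:: u; v; x; y] ->
  join u v (join x y D) = join x y (join u v D).
Proof.
rewrite /= !inE !negb_or => /and4P[/and3P[/eqP ? /eqP ? /eqP ?] /andP[/eqP ? /eqP ?] /eqP ? _].
apply: abacus_ext => z; rewrite !opE /join_partner /join_beads !opE /join_partner /join_beads.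
arc D z; arc D u; arc D v; arc D x; arc D y; split.
  by split_eq.
by split_eq; rewrite addrA.
Qed.

Lemma join_add_beads b u v D : join u v (add_beads b u D) = join u v (add_beads b v D).
Proof.
have [->//|/eqP uv] := eqVneq u v.
apply: abacus_ext => x; rewrite !opE /join_partner /join_beads !opE.
by arc D x; arc D u; arc D v; split; split_eq; rewrite !addr0 ?addrA // addrAC.
Qed.

Lemma add_beads_arc b u v D : partner D u = v -> add_beads b u D = add_beads b v D.
Proof.
move=> Du; apply: abacus_ext => x; rewrite !opE.
by arc D x; arc D u; split => //; split_eq.
Qed.

Lemma join_add_beads_far b x u v D : x != u -> x != v ->
  add_beads b x (join u v D) = join u v (add_beads b x D).
Proof.
move=> /eqP xu /eqP xv; have [<-|/eqP uv] := eqVneq u v.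
  by apply: abacus_ext => z; rewrite !opE /join_partner /join_beads !opE /join_partner eqxx.
apply: abacus_ext => z; rewrite !opE /join_partner /join_beads !opE /join_partner.
arc D z; arc D u; arc D v; arc D x; split; split_eq;
  by rewrite !addr0 ?addrA // addrAC.
Qed.

(** The beads vanish with the closed loop; this gives the relation [t o^k t = t]. *)
Lemma join_arc_beads b u v D : partner D u = v -> 
  join u v (add_beads b u D) = join u v D.
Proof.
move=> Du; apply: abacus_ext => x; rewrite !opE /join_partner /join_beads !opE.
by arc D x; arc D u; arc D v; split; split_eq; rewrite addr0.
Qed.

Lemma add_beadsD b c u D : add_beads b u (add_beads c u D) = add_beads (b + c)%R u D.
Proof.
apply: abacus_ext => x; rewrite !opE; split=> //.
by case: ifP => _; rewrite ?addr0 // -addrA [(c + b)%R]addrC.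
Qed.

Lemma add_beads0 u D : add_beads 0%R u D = D.
Proof. by apply: abacus_ext => x; rewrite !opE if_same addr0. Qed.

Lemma add_beadsC b c u v D : add_beads b u (add_beads c v D) = add_beads c v (add_beads b u D).
Proof. by apply: abacus_ext => x; rewrite !opE addrAC. Qed.

Lemma partner_join_arc u v D : u != v -> partner (join u v D) u = v.
Proof. by move=> /negbTE uv; rewrite !opE /join_partner uv eqxx. Qed.

Lemma beads_join_arc u v D : u != v -> beads (join u v D) u = 0%R.
Proof. by move=> /negbTE uv; rewrite !opE /join_beads uv eqxx. Qed.

Lemma join_join u v w D : uniq [:: u; v; w] ->
  join u v (join u w D) = relabel v w (join u w D).
Proof.
rewrite /= !inE !negb_or => /and3P[/andP[uv uw] vw _].
by apply: join_arc => //; rewrite ?partner_join_arc ?beads_join_arc.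
Qed.

Lemma joinK u v D : u != v -> join u v (join u v D) = join u v D.
Proof. by move=> uv; apply: join_id; rewrite ?partner_join_arc ?beads_join_arc. Qed.

Lemma join_relabel_conj u v x y D : join x y (relabel u v D) =
  relabel u v (join (tperm u v x) (tperm u v y) D).
Proof. by rewrite relabel_join !tpermK. Qed.

Lemma relabel_join_id u v D : u != v -> relabel u v (join u v D) = join u v D.
Proof. by move=> uv; rewrite relabel_id // partner_join_arc. Qed.

Lemma join_relabel u v D : u != v -> join u v (relabel u v D) = join u v D.
Proof.
by move=> uv; rewrite join_relabel_conj tpermL tpermR joinC relabel_join_id.
Qed.

Lemma tperm_far u v x : x != u -> x != v -> tperm u v x = x.
Proof. by move=> xu xv; rewrite tpermD // eq_sym. Qed.

Section Triple.
Variables u v w : point.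
Hypothesis uvw : uniq [:: u; v; w].
Let uv : u != v. Proof. by case/andP: uvw; rewrite !inE negb_or => /andP[]. Qed.
Let uw : u != w. Proof. by case/andP: uvw; rewrite !inE negb_or => /andP[]. Qed.
Let vw : v != w. Proof. by case/and3P: uvw; rewrite !inE. Qed.

Lemma relabel_braid D : relabel u v (relabel v w (relabel u v D)) =
  relabel v w (relabel u v (relabel v w D)).
Proof.
rewrite relabel_relabel tpermR (tperm_far (x := w)) ?(eq_sym w) // relabelKK.
by rewrite [RHS]relabel_relabel tpermL (tperm_far (x := u)) // relabelKK.
Qed.

(** The first join leaves a bead-free arc from [v] to [u], so [join_arc] turns the second into an
    exchange. *)
Lemma join_join_mid D :
  join v w (join u v D) = relabel w u (join u v D).
Proof.
rewrite (joinC u v D); apply: join_join.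
by rewrite /= !inE !negb_or vw (eq_sym v) uv (eq_sym w) uw.
Qed.

Lemma join_triple D : join u v (join v w (join u v D)) = join u v D.
Proof.
rewrite join_join_mid join_relabel_conj tpermR tperm_far //; last by rewrite eq_sym.
by rewrite joinC join_join_mid relabelKK.
Qed.

Lemma relabel_join_join D :
  relabel u v (join v w (join u v D)) = relabel v w (join u v D).
Proof.
rewrite join_join_mid relabel_relabel tpermL tperm_far ?(eq_sym w) //.
by rewrite relabel_join_id // relabelC.
Qed.

Lemma join_join_relabel D :
  join u v (join v w (relabel u v D)) = join u v (relabel v w D).
Proof.
rewrite join_relabel_conj tpermR tperm_far ?(eq_sym w) // join_relabel // join_join //.
by rewrite join_relabel_conj tpermL tperm_far.
Qed.
End Triple.
End Operators.

(** * Elementary diagrams as operators *)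

Section LeftMultiplication.
Variables d n : nat.
Local Notation point := (Defs.point n).
Local Notation bead := (bead d).
Local Notation abacus := (abacus d n).
Implicit Types (a D E : abacus) (x y : point) (b w : bead).
Local Notation sseg a D := (seg (stack_arc a D) (stack_beads a D) (@stack_glue n)).

(** A segment between outer points determines the strand, so exhibiting one per outer point computes
    the product without reference to fuel. *)
Lemma mul_seg a D E : 
  (forall x, exists k, sseg a D k (outer x) (outer (partner E x)) (beads E x)) ->
  (a * D)%g = E.
Proof.
move=> H; apply: abacus_ext => x; have [k /concat_eq[<- <-]] := H x.
by rewrite partner_mk beads_mk.
Qed.

Lemma seg_exit_bottom a D y k w :
  partner D y = inr k -> beads D y = w -> sseg a D 0 (inr y) (outer (inr k)) w.
Proof. by move=> Dy Dw; apply: sseg_one; rewrite /= ?Dy. Qed.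

Lemma seg_exit_top a D y j j' w w' :
  partner D y = inl j -> beads D y = w -> partner a (inr j) = inl j' -> beads a (inr j) = w' ->
  sseg a D 1 (inr y) (outer (inl j')) (w + w')%R.
Proof.
move=> Dy <- aj aw; apply: (@seg_step _ _ _ _ _ _ _ (inl (inr j))); first by rewrite /= Dy.
by apply: sseg_one; rewrite /= ?aj.
Qed.

Lemma seg_enter a D j j' (v : stacked n) k w w' :
  partner a (inl j) = inr j' -> beads a (inl j) = w ->
  sseg a D k (inr (inl j')) v w' -> sseg a D k.+1 (outer (inl j)) v (w + w')%R.
Proof.
by move=> aj <-; apply: seg_step; rewrite /= aj.
Qed.

Definition top_map (p : 'I_n -> 'I_n) x : point :=
  match x with inl j => inl (p j) | inr k => inr k end.
Definition top_beads a x : bead := if x is inl j then beads a (inl j) else 0%R.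

(** Serves for [s], with [p] a transposition, and for [o], with [p] the identity: a strand consists
    of one arc of [D], preceded and followed by at most one arc of [a]. *)
Lemma mul_permutation a D E (p : 'I_n -> 'I_n) : involutive p ->
  (forall j, partner a (inl j) = inr (p j)) ->
  (forall x, partner E x = top_map p (partner D (top_map p x))) ->
  (forall x, beads E x = (top_beads a x + (beads D (top_map p x) +
     top_beads a (partner E x)))%R) ->
  (a * D)%g = E.
Proof.
move=> pK ap Ep Eb; apply: mul_seg => x.
have ap' j : partner a (inr j) = inl (p j) by rewrite -(pK j) -ap partnerK pK.
have ab' j : beads a (inr j) = beads a (inl (p j)).
  by rewrite -[in RHS]beads_partner ap pK.
have [k H] : exists k, sseg a D k (inr (top_map p x)) (outer (partner E x))
    (beads D (top_map p x) + top_beads a (partner E x))%R.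
  rewrite Ep; case Dx: (partner D _) => [j|j].
    by exists 1%N; apply: (seg_exit_top Dx erefl (ap' j) (ab' j)).
  exists 0%N; rewrite /= addr0. refine (@seg_exit_bottom a D _ j _ Dx erefl).
rewrite Eb; case: x H => [j|j] H; last by exists k; rewrite add0r.
by exists k.+1; apply: seg_enter H.
Qed.

Lemma top_map_tperm i j x : top_map (tperm i j) x = tperm (inl i) (inl j) x.
Proof.
by case: x => k /=; [rewrite (inj_tperm _ _ _ (@inl_inj _ _)) | rewrite tpermD].
Qed.

Lemma mul_s i D : (abacus_s d i * D)%g = relabel (inl (lo i)) (inl (hi i)) D.
Proof.
apply: (@mul_permutation _ _ _ (tperm (lo i) (hi i))).
- exact: tpermK.
- by move=> j; rewrite partner_mk.
- by move=> x; rewrite !opE !top_map_tperm.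
have b0 x : top_beads (abacus_s d i) x = 0%R.
  by case: x => [j|//]; rewrite /= beads_mk.
by move=> x; rewrite !b0 !opE top_map_tperm add0r addr0.
Qed.

Lemma mul_o i D : (abacus_o d i * D)%g = add_beads (inZp 1) (inl i) D.
Proof.
have tE x : top_map id x = x by case: x.
apply: (@mul_permutation _ _ _ id) => // [j|x|x]; rewrite ?opE ?partner_mk ?tE //.
have tb y : top_beads (abacus_o d i) y = if y == inl i then inZp 1 else 0%R.
  by case: y => j //=; rewrite beads_mk.
rewrite !tb; case: eqP => [->|_] /=.
  by rewrite (negbTE (partner_neq D _)) addr0 addrC.
by case: eqP; rewrite ?add0r.
Qed.

(** A strand that reaches [u] or [v] from elsewhere in [D] runs along the lower arc of [a] and
    resumes at the other point; the upper arc is the new arc of the join. *)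
Lemma mul_t i D : (abacus_t d i * D)%g = join (inl (lo i)) (inl (hi i)) D.
Proof.
set a := abacus_t d i; set u := inl _; set v := inl _.
have uv : u != v by rewrite (inj_eq inl_inj) lo_neq_hi.
have ab x : beads a x = 0%R by rewrite beads_mk.
have tperm_uv j : (inl (tperm (lo i) (hi i) j) : point) = tperm u v (inl j).
  by rewrite (inj_tperm _ _ _ (@inl_inj _ _)).
have a_in j : inl j \in [:: u; v] -> partner a (inl j) = tperm u v (inl j).
  by rewrite !inE !(inj_eq inl_inj) => jE; rewrite partner_mk /= !inE jE tperm_uv.
have a_out j : inl j \notin [:: u; v] ->
    partner a (inl j) = inr j /\ partner a (inr j) = inl j.
  by rewrite !inE !(inj_eq inl_inj) => /negbTE jE; rewrite !partner_mk /= !inE jE.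
have a_u : partner a (inr (lo i)) = inr (hi i).
  by rewrite partner_mk /= !inE eqxx tpermL.
have a_v : partner a (inr (hi i)) = inr (lo i).
  by rewrite partner_mk /= !inE eqxx orbT tpermR.
have exit_out y : y \notin [:: u; v] -> exists k,
    sseg a D k (inr y) (outer (join_partner u v D y)) (join_beads u v D y).
  rewrite !inE negb_or => /andP[yu yv].
  rewrite /join_partner /join_beads (negbTE uv) (negbTE yu) (negbTE yv) /=.
  have last y' : partner D y' != u -> partner D y' != v ->
      exists k, sseg a D k (inr y') (outer (partner D y')) (beads D y').
    case Dy: (partner D y') => [j|j] ju jv; last by exists 0%N; apply: seg_exit_bottom.
    exists 1%N; rewrite -[beads D y']addr0; apply: (seg_exit_top Dy) => //.
    by have [] := a_out j => //; rewrite !inE negb_or ju.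
  have [Dy|yu'] := eqVneq (partner D y) u.
    have [k H] : exists k, sseg a D k (inr v) (outer (partner D v)) (beads D v).
      apply: last; last exact: partner_neq.
      by rewrite -Dy (can_eq (partnerK D)) eq_sym.
    (* Two arcs precede the rest of the strand: the one of [D] from [y] to [u], and the bead-free
       lower arc of [a]. *)
    exists k.+2; rewrite -(add0r (beads D v)) -[X in (X + beads D v)%R](ab (inr (lo i))).
    apply: (@seg_step _ _ _ _ _ _ _ (inl (inr (lo i)))); first by rewrite /= Dy.
    by apply: seg_step H; rewrite /= a_u.
  have [Dy|yv'] := eqVneq (partner D y) v; last exact: last.
  have [k H] : exists k, sseg a D k (inr u) (outer (partner D u)) (beads D u).
    apply: last; first exact: partner_neq.
    by rewrite -Dy (can_eq (partnerK D)) eq_sym.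
  exists k.+2; rewrite -(add0r (beads D u)) -[X in (X + beads D u)%R](ab (inr (hi i))).
  apply: (@seg_step _ _ _ _ _ _ _ (inl (inr (hi i)))); first by rewrite /= Dy.
  by apply: seg_step H; rewrite /= a_v.
apply: mul_seg => x; rewrite !opE.
have [xuv|xuv] := boolP (x \in [:: u; v]); last first.
  have [k H] := exit_out x xuv; case: x xuv H => j xuv H; last by exists k.
  exists k.+1; rewrite -[join_beads _ _ _ _]add0r.
  by apply: seg_enter H => //; case: (a_out j xuv).
case: x xuv => [j|//] ju; exists 0%N; apply: sseg_one; rewrite /= ?(a_in _ ju) ?ab.
  move: ju; rewrite /join_partner (negbTE uv) !inE permE /=.
  by case: eqP => //= _ /eqP->; rewrite eqxx.
by move: ju; rewrite /join_beads (negbTE uv) !inE => ->.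
Qed.

End LeftMultiplication.

(** * Evaluation of words and validity of the relations *)

Section Evaluation.
Local Open Scope group_scope.
Variables d n : nat.
Hypothesis d_gt0 : (0 < d)%N.
Local Notation point := (Defs.point n).
Local Notation abacus := (abacus d n).
Local Notation gen := (@abacus_gen d n).
Implicit Types (D E : abacus) (u v w : seq (fgen n)).

Definition eval u : abacus := \prod_(x <- u) gen x.

Lemma eval_cons x u : eval (x :: u) = gen x * eval u.
Proof. by rewrite /eval big_cons. Qed.
Lemma eval_cat u v : eval (u ++ v) = eval u * eval v.
Proof. by rewrite /eval big_cat. Qed.
Lemma eval_nil : eval [::] = 1.
Proof. by rewrite /eval big_nil. Qed.

Local Notation L i := (inl (lo i) : point).
Local Notation H i := (inl (hi i) : point).

Lemma LH i : L i != H i.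
Proof. by rewrite (inj_eq inl_inj) lo_neq_hi. Qed.

Lemma far_points i j : far i j -> uniq [:: L i; H i; L j; H j].
Proof.
rewrite /far => ij; rewrite /= !inE !(inj_eq inl_inj) -!val_eqE /=; lia.
Qed.

(** With [v] the shared point, the cases [j = i + 1] and [j = i - 1] look alike, as exchanges and
    joins are symmetric in their two points. *)
Lemma adjacent_points i j : adjacent i j -> exists u v w : point, [/\ uniq [:: u; v; w],
  forall D, relabel (L i) (H i) D = relabel u v D,
  forall D, relabel (L j) (H j) D = relabel v w D,
  forall D, join (L i) (H i) D = join u v D &
  forall D, join (L j) (H j) D = join v w D].
Proof.
have key (i' j' : 'I_n.-1) : i'.+1 = j' -> H i' = L j' /\ uniq [:: L i'; H i'; H j'].
  move=> E; split; first by congr inl; apply: val_inj.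
  by rewrite /= !inE !(inj_eq inl_inj) -!val_eqE /=; lia.
case/orP=> /eqP /key [E U].
  by exists (L i), (H i), (H j); rewrite -E.
exists (H i), (H j), (L j); rewrite -E; split=> [|D|D|D|D].
- by rewrite -rev_uniq.
- exact: relabelC.
- exact: relabelC.
- exact: joinC.
- exact: joinC.
Qed.

Lemma eval_mul u D : eval u * D = foldr (fun x E => gen x * E) D u.
Proof.
by elim: u => [|x u IH] /=; rewrite ?eval_nil ?mul1g // eval_cons -mulgA IH.
Qed.

Lemma mul_o_nseq k i D :
  foldr (fun x E => gen x * E) D (nseq k (FZ i)) = add_beads (inZp k) (inl i) D.
Proof.
elim: k => [|k IH] /=.
  by rewrite (_ : inZp 0 = 0%R) ?add_beads0 //; apply: val_inj; rewrite /= mod0n.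
rewrite IH mul_o add_beadsD; congr add_beads.
by apply: val_inj; rewrite /= modnDm.
Qed.

Lemma eval_rel u v : framed_rel d u v -> eval u = eval v.
Proof.
(* Equality of the actions on all [D] suffices, by taking [D = 1]; each relation becomes an identity
   of operators. *)
move=> uv; suff E D : eval u * D = eval v * D by rewrite -[eval u]mulg1 E mulg1.
rewrite !eval_mul.
case: uv => {u v} /= [i|i j ij|i j ij|i|i j ij|i j ij|i|i|i j ij|i j ij|i j ij
  |j|i j|i j|i|i|i j il ih|i k];
  rewrite ?foldr_cat ?mul_o_nseq /= ?mul_s ?mul_t ?mul_o.
- by rewrite relabelKK.
- move/far_points: ij; rewrite /= !inE !negb_or => /and4P[/and3P[? ? ?] /andP[? ?] _ _].
  by rewrite relabel_relabel !tperm_far // eq_sym.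
- have [x [y [z [U si sj ti tj]]]] := adjacent_points ij.
  by rewrite !si !sj relabel_braid.
- by rewrite joinK ?LH.
- by rewrite join_join_far // far_points.
- have [x [y [z [U si sj ti tj]]]] := adjacent_points ij.
  by rewrite !ti tj join_triple.
- by rewrite join_relabel ?LH.
- by rewrite relabel_join_id ?LH.
- move/far_points: ij; rewrite /= !inE !negb_or => /and4P[/and3P[? ? ?] /andP[? ?] _ _].
  by rewrite relabel_join !tperm_far // eq_sym.
- have [x [y [z [U si sj ti tj]]]] := adjacent_points ij.
  by rewrite ?si ?sj ?ti ?tj relabel_join_join.
- have [x [y [z [U si sj ti tj]]]] := adjacent_points ij.
  by rewrite ?si ?sj ?ti ?tj join_join_relabel.
- by rewrite (_ : inZp d = 0%R) ?add_beads0 //; apply: val_inj; rewrite /= prednK // modnn.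
- by rewrite add_beadsC.
- rewrite relabel_add_beads; congr add_beads.
  by rewrite -(inj_tperm _ _ _ (@inl_inj _ _)) tpermK.
- by rewrite join_add_beads.
- by apply: add_beads_arc; rewrite partner_join_arc ?LH.
- by rewrite join_add_beads_far // (inj_eq inl_inj).
- by rewrite join_arc_beads ?joinK ?partner_join_arc ?LH.
Qed.

Lemma eval_wcong u v : wcong (@framed_rel d n) u v -> eval u = eval v.
Proof.
elim=> {u v} [l u v r /eval_rel uv|//|u v _ ->//|u v w _ -> _ -> //].
by rewrite !eval_cat uv.
Qed.

Definition eval_pres (x : framed_brauer d n) : abacus := eval (repr x).

Lemma eval_pres_class u : eval_pres (pres_class (@framed_rel d n) u) = eval u.
Proof. by apply/eval_wcong/pres_classP; rewrite pres_reprK. Qed.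

End Evaluation.

(** * Generation by the elementary diagrams *)

Section Generation.
Local Open Scope group_scope.
Variables d n : nat.
Local Notation point := (Defs.point n).
Local Notation abacus := (abacus d n).
Local Notation gen := (@abacus_gen d n).
Implicit Types (D E : abacus) (u v w : seq (fgen n)) (a b c j k : 'I_n).

Definition generated D := exists u, eval d u = D.

Lemma generated_mul x D : generated D -> generated (gen x * D).
Proof. by case=> u <-; exists (x :: u); rewrite eval_cons. Qed.

Lemma hi_lo a b : a.+1 = b :> nat -> exists i : 'I_n.-1, a = lo i /\ b = hi i.
Proof.
move=> ab; have an : (a < n.-1)%N by have := ltn_ord b; lia.
by exists (Ordinal an); split; apply: val_inj.
Qed.

(** Induction on the distance: the exchange of [a] and [b] is that of [a] and [b - 1] conjugated by
    the elementary exchange of [b - 1] and [b]. *)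
Lemma generated_relabel a b D :
  generated D -> generated (relabel (inl a) (inl b) D).
Proof.
wlog ab : a b / (a <= b)%N.
  move=> H; have [/H//|/ltnW ba] := leqP a b.
  by rewrite relabelC; apply: H.
have [l El] : exists l : nat, (b - a = l)%N by exists (b - a)%N.
elim: l b ab El D => [|l IH] b ab El D gD.
  have -> : b = a by apply: val_inj => /=; lia.
  suff -> : relabel (inl a) (inl a) D = D by [].
  by apply: abacus_ext => x; rewrite !opE !tperm1 !perm1.
have cn : (b.-1 < n)%N by have := ltn_ord b; lia.
pose c := Ordinal cn; have [i [ci bi]] : exists i, c = lo i /\ b = hi i.
  by apply: hi_lo => /=; lia.
have gcb E : generated E -> generated (relabel (inl c) (inl b) E).
  by move=> gE; rewrite ci bi -mul_s; apply: (generated_mul (FS i)).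
have [ac|ac] := eqVneq a c; first by rewrite ac; apply: gcb.
have ab' : a != b by rewrite -val_eqE /=; lia.
suff <- : relabel (inl c) (inl b) (relabel (inl a) (inl c) (relabel (inl c) (inl b) D)) =
    relabel (inl a) (inl b) D.
  by apply/gcb/IH => /=; [lia | lia | apply: gcb].
by rewrite relabel_relabel tpermL tperm_far ?relabelKK // (inj_eq inl_inj).
Qed.

(** Conjugation by an exchange brings [b] next to [a], where joining is multiplication by some
    [t]. *)
Lemma generated_join a b D :
  a != b -> generated D -> generated (join (inl a) (inl b) D).
Proof.
wlog ab : a b / (a < b)%N.
  move=> H neq; have [ab|ab] := ltnP a b; first exact: H.
  rewrite joinC; apply: H; last by rewrite eq_sym.
  by rewrite ltn_neqAle ab val_eqE eq_sym neq.
move=> neq gD; have cn : (a.+1 < n)%N by have := ltn_ord b; lia.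
pose c := Ordinal cn; have [i [ai ci]] : exists i, a = lo i /\ c = hi i.
  exact: hi_lo.
have ac : a != c by rewrite -val_eqE /=; lia.
suff -> : join (inl a) (inl b) D = relabel (inl c) (inl b)
    (join (inl a) (inl c) (relabel (inl c) (inl b) D)).
  apply: generated_relabel; rewrite ai ci -mul_t.
  by apply: (generated_mul (FT i)); apply: generated_relabel.
by rewrite relabel_join tpermL tperm_far ?relabelKK // (inj_eq inl_inj).
Qed.

Lemma generated_add_beads (b : bead d) j D :
  generated D -> generated (add_beads b (inl j) D).
Proof.
case=> u <-; exists (nseq b (FZ j) ++ u); by rewrite eval_cat eval_mul mul_o_nseq valZpK.
Qed.

Lemma generated_add_beadsV (b : bead d) j D :
  generated (add_beads b (inl j) D) -> generated D.
Proof.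
move/(generated_add_beads (- b)%R j).
by rewrite add_beadsD addNr add_beads0.
Qed.

Lemma generated_relabelV a b D :
  generated (relabel (inl a) (inl b) D) -> generated D.
Proof. by move/(generated_relabel a b); rewrite relabelKK. Qed.

(** Below, [mu] counts the defects of a diagram, and each step removes some by an operation that can
    be undone by generators. *)
Lemma descent (mu : abacus -> nat) (Q : abacus -> Prop) :
  (forall D, Q D -> generated D \/
    exists D', [/\ Q D', (mu D' < mu D)%N & generated D' -> generated D]) ->
  forall D, Q D -> generated D.
Proof.
move=> step D; have [m] := ubnP (mu D); elim: m D => // m IH D mD QD.
have [//|[D' [QD' lt gD]]] := step D QD.
by apply/gD/IH => //; lia.
Qed.

Lemma generated_vertical D :
  (forall j, partner D (inl j) = inr j) -> generated D.
Proof.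
move: D; apply: (@descent (fun D => #|[set j | beads D (inl j) != 0%R]|)) => D vD.
have [j bj|b0] := pickP [pred j | beads D (inl j) != 0%R]; last first.
  left; exists [::]; rewrite eval_nil; apply: abacus_ext => x.
  rewrite partner_mk beads_mk; have bD j : beads D (inl j) = 0%R.
    by have := b0 j => /= /negbFE/eqP.
  case: x => j; first by rewrite vD bD.
  by rewrite -(vD j) partnerK beads_partner bD vD.
right; exists (add_beads (- beads D (inl j))%R (inl j) D); split.
- by move=> k; rewrite !opE.
- apply: proper_card; apply/properP; split.
    apply/fintype.subsetP=> k; rewrite !inE !opE vD orbF (inj_eq inl_inj).
    by have [->|] := eqVneq k j; rewrite ?addr0.
  by exists j; rewrite !inE // !opE eqxx /= subrr eqxx.
- exact: generated_add_beadsV.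
Qed.

(** The map from [j] to [k] is an injection of a finite set into itself, hence onto. *)
Lemma partner_onto D (e e' : 'I_n -> point) : injective e ->
  (forall j, exists k, partner D (e j) = e' k) ->
  forall k, exists j, partner D (e' k) = e j.
Proof.
move=> e_inj /fin_all_exists[h hE] k.
have h_inj : injective h.
  by move=> i j Eh; apply/e_inj/(inv_inj (partnerK D)); rewrite !hE Eh.
have [f _ fK] := injF_bij h_inj.
by exists (f k); rewrite -(fK k) -hE partnerK fK.
Qed.

Lemma generated_through D :
  (forall j, exists k, partner D (inl j) = inr k) -> generated D.
Proof.
move: D; apply: (@descent (fun D => #|[set j | partner D (inl j) != inr j]|)) => D tD.
have [j bj|v0] := pickP [pred j | partner D (inl j) != inr j]; last first.
  by left; apply: generated_vertical => j; have := v0 j => /= /negbFE/eqP.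
(* Exchanging top [j] and top [k] makes the strand at [j] vertical and spoils no other, as the one
   at [k] was not vertical. *)
have [k Dj] := partner_onto (@inl_inj _ _) tD j.
have Dk : partner D (inl k) = inr j by rewrite -Dj partnerK.
have kj : k != j by apply: contraNneq (bj : _ != _) => kj; rewrite -{1}kj Dk.
have D'E l : partner (relabel (inl j) (inl k) D) (inl l) = partner D (inl (tperm j k l)).
  rewrite !opE -(inj_tperm _ _ _ (@inl_inj _ _)).
  by have [l' ->] := tD (tperm j k l); rewrite tpermD.
right; exists (relabel (inl j) (inl k) D); split.
- by move=> l; rewrite D'E; apply: tD.
- apply: proper_card; apply/properP; split.
    apply/fintype.subsetP=> l; rewrite !inE D'E; case: tpermP => [->|->|//].
      by rewrite Dk eqxx.
    by move=> _; rewrite Dk (inj_eq inr_inj) eq_sym.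
  by exists j; rewrite !inE // D'E tpermL Dk eqxx.
- exact: generated_relabelV.
Qed.

Lemma generated_all D : generated D.
Proof.
pose is_top (x : point) := if x is inl _ then true else false.
apply: (@descent (fun D => #|[set j | is_top (partner D (inl j))]|) (fun=> True)) => // {}D _.
have [j Tj|noT] := pickP [pred j | is_top (partner D (inl j))]; last first.
  left; apply: generated_through => j; have := noT j => /=.
  by case: (partner D (inl j)) => // k _; exists k.
have [k Dj] : exists k, partner D (inl j) = inl k.
  by move: Tj => /=; case: (partner _ _) => // k _; exists k.
(* A top arc forces a bottom arc: otherwise [partner_onto] would link every top point to the bottom
   line. *)
have [c [e Dc]] : exists c e, partner D (inr c) = inr e.
  have [c bc|noB] := pickP [pred c | ~~ is_top (partner D (inr c))].
    by exists c; move: bc => /=; case: (partner _ _) => // e _; exists e.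
  have DB c : exists l, partner D (inr c) = inl l.
    by have := noB c => /=; case: (partner _ _) => // l _; exists l.
  by have [l] := partner_onto (@inr_inj _ _) DB j; rewrite Dj.
pose b := beads D (inl j); pose D1 := add_beads (- b)%R (inl j) D.
have D1j : partner D1 (inl j) = inl k by rewrite !opE.
have b1j : beads D1 (inl j) = 0%R by rewrite !opE eqxx subrr.
have kj : k != j by have := partner_neq D (inl j); rewrite Dj.
(* This is [join_arc] read backwards, whence the removal of the beads first. In the diagram to be
   joined, top [j] and [k] are linked to bottom [c] and [e]. *)
have D1E : join (inl j) (inl k) (relabel (inl k) (inr c) D1) = D1.
  rewrite relabelC -(join_arc D1j b1j) // join_join; last first.
    by rewrite /= !inE (inj_eq inl_inj) eq_sym (negbTE kj).
  by rewrite (join_arc D1j b1j) // relabelC relabelKK.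
right; exists (relabel (inl k) (inr c) D1); split=> //.
  have D'k : partner (relabel (inl k) (inr c) D1) (inl k) = inr e.
    rewrite !opE tpermL Dc tpermD // (inj_eq inr_inj).
    by apply: contraTneq (partner_neq D (inr c)) => ce; rewrite Dc ce eqxx.
  apply: proper_card; apply/properP; split; last first.
    by exists k; rewrite !inE ?D'k // -Dj partnerK.
  apply/fintype.subsetP=> l; rewrite !inE; have [->|lk] := eqVneq l k; first by rewrite D'k.
  rewrite !opE (@tpermD _ _ _ (inl l)) // ?(inj_eq inl_inj) 1?eq_sym //.
  case Dl: (partner D (inl l)) => [//|m]; have [mc|mc] := eqVneq m c.
    by move: Dc; rewrite -mc -Dl partnerK.
  by rewrite tpermD // (inj_eq inr_inj) eq_sym.
move=> g; apply: (@generated_add_beadsV (- b)%R j).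
by rewrite -/D1 -D1E; apply: generated_join => //; rewrite eq_sym.
Qed.

End Generation.

(** * Counting *)

Section CountMatchings.
Variables (V : finType) (W : finZmodType).
Implicit Types (S : {set V}) (D : {ffun V -> V} * {ffun V -> W}).
Local Open Scope ring_scope.

(** Points outside [S] are fixed with weight 0, so that each weighted matching of [S] is encoded
    exactly once. *)
Definition matching_on S D : bool :=
  [forall x, [&& D.1 (D.1 x) == x, D.2 (D.1 x) == D.2 x,
     (D.1 x != x) == (x \in S) & (x \in S) || (D.2 x == 0)]].

Lemma matching_onP S D : reflect (forall x, [/\ D.1 (D.1 x) = x,
    D.2 (D.1 x) = D.2 x, (D.1 x != x) = (x \in S) & x \notin S -> D.2 x = 0])
  (matching_on S D).
Proof.
apply: (iffP forallP) => H x; have := H x.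
  case/and4P=> /eqP-> /eqP-> /eqP-> /orP xS; split=> //.
  by move/negP; case: xS => // /eqP.
case=> -> -> -> xS; rewrite !eqxx /=; case: (boolP (x \in S)) => //= /xS ->.
by rewrite eqxx.
Qed.

(** The injection [F] adds an arc of weight [w]: as [D.1] fixes [x] and [y], composing it with their
    transposition links them. *)
Lemma matching_fiber S x y (w : W) : x \in S -> y \in S -> x != y ->
  (#|[set D | matching_on (S :\ x :\ y) D]| <=
   #|[set D in [set D | matching_on S D] | (D.1 x, D.2 x) == (y, w)]|)%N.
Proof.
move=> xS yS xy.
pose F D := ([ffun z => D.1 (tperm x y z)],
             [ffun z => if (z == x) || (z == y) then w else D.2 z]) :
             {ffun V -> V} * {ffun V -> W}.
have fixed D : matching_on (S :\ x :\ y) D ->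
    [/\ D.1 x = x, D.1 y = y, D.2 x = 0 & D.2 y = 0].
  move=> /matching_onP MD; have [_ _ Hx Gx] := MD x; have [_ _ Hy Gy] := MD y.
  have xN : x \notin S :\ x :\ y by rewrite !inE eqxx /= andbF.
  have yN : y \notin S :\ x :\ y by rewrite !inE eqxx.
  split; [apply/eqP|apply/eqP|exact: Gx|exact: Gy].
    by apply: contraNT xN; rewrite Hx.
  by apply: contraNT yN; rewrite Hy.
rewrite -(card_in_imset (f := F)); last first.
  move=> D D'; rewrite !inE => /fixed[fx fy gx gy] /fixed[fx' fy' gx' gy'].
  case=> /ffunP E1 /ffunP E2.
  case: D fx fy gx gy E1 E2 => f g /= fx fy gx gy E1 E2.
  case: D' fx' fy' gx' gy' E1 E2 => f' g' /= fx' fy' gx' gy' E1 E2.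
  congr pair; apply/ffunP => z.
    by have := E1 (tperm x y z); rewrite !ffunE tpermK.
  have := E2 z; rewrite !ffunE; case: eqP => [->|_]; first by rewrite gx gx'.
  by case: eqP => [->|//]; rewrite gy gy'.
apply/subset_leq_card/fintype.subsetP => _ /imsetP[D +->]; rewrite !inE => MD.
have [fx fy gx gy] := fixed _ MD; rewrite /F /= !ffunE tpermL fy !eqxx /= andbT.
have ft z : D.1 (tperm x y z) = tperm x y (D.1 z).
  have [fK _ _ _] := (matching_onP _ _ MD) z.
  case: tpermP => [->|->|/eqP zx /eqP zy]; rewrite ?fx ?fy ?tpermL ?tpermR //.
  rewrite tpermD //.
    by apply: contraNneq zx => E; rewrite -fK -E fx.
  by apply: contraNneq zy => E; rewrite -fK -E fy.
apply/matching_onP => z; rewrite /= !ffunE; have [fK gf fS gS] := (matching_onP _ _ MD) z.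
rewrite !ft !tpermK fK.
have [->|zx] := eqVneq z x.
  by rewrite fx tpermL !eqxx (eq_sym y) (negbTE xy) xS.
have [->|zy] := eqVneq z y.
  by rewrite fy tpermR !eqxx (negbTE xy) orbT yS.
have fzx : D.1 z != x by apply: contraNneq zx => E; rewrite -fK E fx.
have fzy : D.1 z != y by apply: contraNneq zy => E; rewrite -fK E fy.
have -> : tperm x y (D.1 z) = D.1 z by rewrite tpermD // eq_sym.
rewrite (negbTE fzx) (negbTE fzy) fS !inE zx zy; split=> //.
by move=> zS; apply: gS; rewrite !inE zx zy.
Qed.

(** Matchings are sorted by the partner and the weight at one point: [(2 * m).+1 * #|W|] classes,
    each bounded below by [matching_fiber]. *)
Lemma leq_matchings m S : #|S| = (2 * m)%N ->
  (dfact (2 * m - 1) * #|W| ^ m <= #|[set D | matching_on S D]|)%N.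
Proof.
elim: m S => [|m IH] S.
  move/cards0_eq=> ->; rewrite card_gt0; apply/finset.set0Pn.
  exists ([ffun z => z], [ffun=> 0]); rewrite inE; apply/matching_onP => z /=.
  by rewrite !ffunE eqxx inE.
move=> cS; have /card_gt0P[x xS] : (0 < #|S|)%N by rewrite cS; lia.
have cSx : #|S :\ x| = (2 * m).+1 by have := cardsD1 x S; rewrite xS cS; lia.
pose K := (dfact (2 * m - 1) * #|W| ^ m)%N.
rewrite -sum1_card.
rewrite (partition_big (fun D => (D.1 x, D.2 x)) (fun p => p.1 \in S :\ x)) /=; last first.
  move=> D; rewrite inE => /matching_onP MD; have [fK _ fS _] := MD x.
  rewrite !inE fS xS /=; have [_ _ <- _] := MD (D.1 x).
  by rewrite fK eq_sym fS.
apply: (@leq_trans (\sum_(p : V * W | p.1 \in S :\ x) K)%N).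
  rewrite sum_nat_const (_ : #|_| = ((2 * m).+1 * #|W|)%N); last first.
    rewrite -cSx -cardsT -cardsX; apply: eq_card => -[y w].
    by rewrite finset.in_setX finset.in_setT andbT.
  by rewrite dfact_step expnS mulnACA (_ : m.+1 + m = (2 * m).+1)%N; last lia.
apply: leq_sum => -[y w] /=; rewrite !inE => /andP[yx yS].
have cT : #|S :\ x :\ y| = (2 * m)%N.
  by have := cardsD1 y (S :\ x); rewrite !inE yx yS cSx => -[].
apply: leq_trans (IH _ cT) _.
apply: leq_trans (matching_fiber w xS yS _) _; first by rewrite eq_sym.
by rewrite -sum1_card; apply: eq_leq; apply: eq_bigl => D; rewrite !inE.
Qed.

End CountMatchings.

Lemma leq_card_abacus d n : (0 < d)%N ->
  (dfact (2 * n - 1) * d ^ n <= #|{: abacus d n}|)%N.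
Proof.
move=> d0; have := @leq_matchings (Defs.point n) (bead d) n [set: Defs.point n].
rewrite cardsT card_sum !card_ord prednK // addnn -mul2n => /(_ erefl) H.
apply: leq_trans H _; rewrite -(fintype.card_image (val_inj : injective (@abacus_data d n))).
apply/subset_leq_card/fintype.subsetP => D; rewrite inE => /matching_onP MD.
suff aD : is_abacus D by apply/fintype.imageP; exists (Abacus aD).
by apply/forallP=> x; have [-> -> -> _] := MD x; rewrite !eqxx finset.in_setT.
Qed.

(** * Comparison of the two cardinalities *)

Section Assembly.
Variables d n : nat.
Hypothesis d_gt0 : (0 < d)%N.
Local Open Scope group_scope.
Local Notation B := (framed_brauer d n).
Local Notation cls := (pres_class (@framed_rel d n)).
Local Notation gen := (pres_gen (@framed_rel d n)).

Lemma clsM u v : (cls u : B) * cls v = cls (u ++ v).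
Proof. exact: pres_mulE. Qed.

Lemma cls_rel u v : framed_rel d u v -> cls u = cls v.
Proof.
by move=> uv; apply/pres_classP; rewrite -[u]cats0 -[v]cats0; apply: (wcong_rel [::]).
Qed.

Lemma gen_exp x k : (gen x : B) ^+ k = cls (nseq k x).
Proof. by elim: k => // k IH; rewrite expgS IH clsM. Qed.

(* The value 1 out of range is junk. *)
Let s (i : nat) : B := if insub i is Some j then gen (FS j) else 1.
Let t (i : nat) : B := if insub i is Some j then gen (FT j) else 1.
Let z (i : nat) : B := if insub i is Some j then gen (FZ j) else 1.

Let sE (i : 'I_n.-1) : s i = cls [:: FS i]. Proof. by rewrite /s valK. Qed.
Let tE (i : 'I_n.-1) : t i = cls [:: FT i]. Proof. by rewrite /t valK. Qed.
Let zE (j : 'I_n) : z j = cls [:: FZ j]. Proof. by rewrite /z valK. Qed.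

Lemma ordP i : (i < n)%N -> exists j : 'I_n, i = j.
Proof. by move=> H; exists (Ordinal H). Qed.
Lemma okP i : (i.+1 < n)%N -> exists j : 'I_n.-1, i = j.
Proof. by move=> H; have H' : (i < n.-1)%N by [lia]; exists (Ordinal H'). Qed.

Lemma mem_all (x : B) : x \in nf_list d s t z n.
Proof.
have zlo (i : 'I_n.-1) : z i = cls [:: FZ (lo i)] by rewrite -zE.
have zhi (i : 'I_n.-1) : z i.+1 = cls [:: FZ (hi i)] by rewrite -zE.
have zX (j : 'I_n) k : z j ^+ k = cls (nseq k (FZ j)).
  by rewrite zE -gen_exp.
apply: (@mem_nf_list _ d n) => //.
- move=> _ /okP[i ->]; rewrite !sE clsM; apply/cls_rel/rel_ss.
- by move=> _ _ /okP[i ->] /okP[j ->] ij; rewrite !sE !clsM; apply/cls_rel/rel_ss_far.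
- by move=> _ _ /okP[i ->] /okP[j ->] ij; rewrite !sE !clsM; apply/cls_rel/rel_sss.
- by move=> _ _ /okP[i ->] /okP[j ->] ij; rewrite !tE !clsM; apply/cls_rel/rel_tt_far.
- by move=> _ _ /okP[i ->] /okP[j ->] ij; rewrite !tE !clsM; apply/cls_rel/rel_ttt.
- by move=> _ /okP[i ->]; rewrite tE sE clsM; apply/cls_rel/rel_ts.
- by move=> _ /okP[i ->]; rewrite tE sE clsM; apply/cls_rel/rel_st.
- by move=> _ _ /okP[i ->] /okP[j ->] ij; rewrite tE sE !clsM; apply/cls_rel/rel_ts_far.
- by move=> _ _ /okP[i ->] /okP[j ->] ij; rewrite !tE !sE !clsM; apply/cls_rel/rel_stt.
- by move=> _ _ /okP[i ->] /okP[j ->] ij; rewrite !tE !sE !clsM; apply/cls_rel/rel_tts.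
- by move=> _ /ordP[j ->]; rewrite zX; apply/cls_rel/rel_zd.
- by move=> _ _ /ordP[i ->] /ordP[j ->]; rewrite !zE !clsM; apply/cls_rel/rel_zz.
- by move=> _ /okP[i ->]; rewrite zlo zhi sE !clsM (cls_rel (rel_zs _ _ _)) tpermL.
- by move=> _ /okP[i ->]; rewrite zlo zhi sE !clsM (cls_rel (rel_zs _ _ _)) tpermR.
- move=> _ _ /okP[i ->] /ordP[j ->] ji jSi; rewrite zE sE !clsM.
  rewrite (cls_rel (rel_zs _ _ _)) tpermD // -val_eqE eq_sym //.
- by move=> _ /okP[i ->]; rewrite zlo zhi tE !clsM; apply/cls_rel/rel_tz.
- by move=> _ /okP[i ->]; rewrite zlo zhi tE !clsM; apply/cls_rel/rel_zt.
- move=> _ _ /okP[i ->] /ordP[j ->] ji jSi; rewrite zE tE !clsM.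
  by apply/cls_rel/rel_zt_far; rewrite -val_eqE.
- move=> _ k /okP[i ->]; rewrite (zX (lo i)) tE (clsM (nseq _ _)) clsM.
  exact: (cls_rel (rel_tzt _ i k)).
rewrite -(pres_reprK x); elim: (repr x) => [|y u IH]; first exact: mspan1.
rewrite -[y :: u]cat1s -clsM; apply: mspan_cons IH; case: y => i.
- by rewrite -sE; apply/brauer_wreath/wreath_s; have := ltn_ord i; lia.
- by rewrite -tE; apply/brauer_t; have := ltn_ord i; lia.
- by rewrite -zE; apply/brauer_wreath/wreath_z.
Qed.

Local Notation phi := (@eval_pres d n).

Lemma eval_presM : {morph phi : x y / x * y}.
Proof. by move=> x y; rewrite -eval_cat -eval_pres_class // -clsM !pres_reprK. Qed.

Lemma eval_pres1 : phi 1 = 1.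
Proof. by rewrite -[RHS](eval_nil d n) -eval_pres_class. Qed.

Lemma eval_pres_gen x : phi (gen x) = abacus_gen d x.
Proof. by rewrite eval_pres_class // eval_cons eval_nil mulg1. Qed.

Let L := nf_list d s t z n.

Lemma eval_pres_onto D : exists x, phi x = D.
Proof. by have [u <-] := generated_all D; exists (cls u); rewrite eval_pres_class. Qed.

Lemma enum_abacus_sub : {subset enum {: abacus d n} <= map phi L}.
Proof.
by move=> D _; have [x <-] := eval_pres_onto D; apply/map_f/mem_all.
Qed.

Lemma size_L : size L = (dfact (2 * n - 1) * d ^ n)%N.
Proof. exact: size_nf_list. Qed.

(** The image of [L] contains all diagrams, of which there are at least [size L], so it has no
    repetition; and [L] exhausts the presented monoid. *)
Lemma eval_pres_inj : injective phi.
Proof.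
have U : uniq (map phi L).
  apply: leq_size_uniq (enum_uniq _) enum_abacus_sub _.
  by rewrite size_map size_L -cardE leq_card_abacus.
move=> x y E; rewrite -(nth_index x (mem_all x)) -(nth_index x (mem_all y)); congr nth.
apply/eqP; rewrite -(nth_uniq (phi x) _ _ U) ?size_map ?index_mem ?mem_all //.
by rewrite !(nth_map x) ?index_mem ?mem_all // !nth_index ?mem_all // E.
Qed.

Lemma card_abacus : #|{: abacus d n}| = (dfact (2 * n - 1) * d ^ n)%N.
Proof.
apply/eqP; rewrite eqn_leq leq_card_abacus // andbT -size_L -(size_map phi) cardE.
exact: uniq_leq_size (enum_uniq _) enum_abacus_sub.
Qed.

Lemma eval_pres_bij : bijective phi.
Proof.
have /fin_all_exists[psi psiK] := eval_pres_onto.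
by exists psi => // x; apply: eval_pres_inj.
Qed.

End Assembly.

Local Open Scope classical_set_scope.

Theorem theorem3p2 (n d : nat) (n_gt0 : (0 < n)%N) (d_gt0 : (0 < d)%N) :
  [/\ presented_by (@framed_rel d n) (@abacus_gen d n),
      monoid_isomorphic (abacus d n) (framed_brauer d n)
    & ([set: framed_brauer d n] #= `I_(dfact (2 * n - 1) * d ^ n)%N)%card].
Proof.
have [psi phiK psiK] := @eval_pres_bij d n d_gt0.
have phiM := @eval_presM d n d_gt0; have phi1 := @eval_pres1 d n d_gt0.
split.
- pose phi : UMagmaMorphism.type (framed_brauer d n) (abacus d n) :=
    HB.pack (@eval_pres d n) (isUMagmaMorphism.Build _ _ (@eval_pres d n) (phi1, phiM)).
  exists phi; split; last exact: eval_pres_gen.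
  by exists psi.
- have psiM : {morph psi : x y / (x * y)%g}.
    by move=> x y; apply: (can_inj phiK); rewrite phiM !psiK.
  have psi1 : psi 1%g = 1%g by rewrite -phi1 phiK.
  pose f : UMagmaMorphism.type (abacus d n) (framed_brauer d n) :=
    HB.pack psi (isUMagmaMorphism.Build _ _ psi (psi1, psiM)).
  by exists f; exists (@eval_pres d n).
(* The presented monoid is numbered through the finite type of diagrams. *)
- apply/card_set_bijP; exists (fun x => enum_rank (eval_pres x) : nat).
  rewrite -(card_abacus n d_gt0); split=> [x _ /=|x y _ _ E|k /= kK].
  + exact: ltn_ord.
  + exact/(can_inj phiK)/enum_rank_inj/val_inj.
  + by exists (psi (enum_val (Ordinal kK))); rewrite //= psiK enum_valK.
Qed.
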